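(* Let $d\ge1$ and let $\mathcal C=(C_L,C_{L-r},\dots,C_{-L})\in\mathbb C^{d+1}$ with $C_LC_{-L}\ne0$. The following are equivalent to each other: (1) $E_{\mathcal C}$ belongs to $\mathbb{HB}$; (2) all roots of $f_{\mathcal C}$ lie in the open unit disk $\{z\in\mathbb C:|z|<1\}$; (3) $D_n(\mathcal C)>0$ for all $1\le n\le d$; (4) $H_{\mathcal C}(t)$ is (well defined and) positive definite for all $0\le t<L$; thus the quasi-canonical system attached to $H_{\mathcal C}(t)$ is a canonical system.
   Context: For an entire function $F$ put $F^\sharp(z)=\overline{F(\bar z)}$. $\mathbb{HB}$ is the set of entire functions $E$ with no real zeros such that $|E^\sharp(z)|<|E(z)|$ for all $z$ with $\Im z>0$. $(L,r)=(d/2,1)$ if $d$ is even and $(L,r)=(d,2)$ if $d$ is odd. $E_{\mathcal C}(z)=\sum_{j=0}^dC_{L-rj}e^{i(L-rj)z}$ and $f_{\mathcal C}(T)=\sum_{j=0}^dC_{-(L-rj)}T^{d-j}$, so that $E_{\mathcal C}(z)=e^{iLz}f_{\mathcal C}(e^{-irz})$. For $1\le n\le d$ let $M_n,N_n$ be the upper triangular $n\times n$ matrices with $(j,k)$ entries ($k\ge j$) $C_{-L+r(k-j)}$ and $C_{L-r(k-j)}$ respectively, and $$L_n^\pm(\mathcal C)=\begin{bmatrix}{}^{\rm t}M_n&\pm{}^{\rm t}\overline{N_n}\\ \pm N_n&\overline{M_n}\end{bmatrix},\quad D_n(\mathcal C)=\det L_n^+(\mathcal C)=\det L_n^-(\mathcal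 C)\in\mathbb R.$$ For $1\le n\le d$ let $z_n^\pm(1),\dots,z_n^\pm(n)$ be the solutions of $$L_n^\pm(\mathcal C)\,{}^{\rm t}\bigl[z_n^\pm(1)\ \cdots\ z_n^\pm(n)\ \ \overline{z_n^\pm(n)}\ \cdots\ \overline{z_n^\pm(1)}\bigr]=\mp\,{}^{\rm t}\bigl[0\cdots0\ \ 2\overline{C_L}\ \ 2C_L\ \ 0\cdots0\bigr],$$ the entries $2\overline{C_L},2C_L$ being the $n$th and $(n+1)$th. Let $Z_k=\begin{bmatrix}\Re z_k^+(1)&\Im z_k^+(1)\\ -\Im z_k^-(1)&\Re z_k^-(1)\end{bmatrix}$; the real symmetric $2\times2$ matrix $H_n$ is defined by $Z_n\cdots Z_1\begin{bmatrix}0&-1\\ 1&0\end{bmatrix}H_n=\begin{bmatrix}0&1\\ -1&0\end{bmatrix}Z_n\cdots Z_1$, and $H_{\mathcal C}(t)=H_n$ for $r(n-1)/2\le t<rn/2$, $1\le n\le d$. The quasi-canonical system attached to $H$ on $[0,L)$ is $-\frac{d}{dt}\begin{bmatrix}A\\ B\end{bmatrix}=z\begin{bmatrix}0&-1\\ 1&0\end{bmatrix}H(t)\begin{bmatrix}A\\ B\end{bmatrix}$ $(z\in\mathbb C)$; it is a canonical system if $H(t)$ is positive semi-definite for almost all $t$, $H\not\equiv0$ on any subset of positive Lebesgue measure, and $H$ is locally integrable. *)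

(* Defs.v *)
From HB Require Import structures.
From mathcomp Require Import all_boot all_order all_algebra complex.
From mathcomp Require Import all_classical all_reals all_analysis.
Set Implicit Arguments.
Unset Strict Implicit.
Unset Printing Implicit Defensive.
Import Order.TTheory GRing.Theory Num.Theory.
Import numFieldNormedType.Exports.
Local Open Scope classical_set_scope.
Local Open Scope ring_scope.

Section EntireFunctions.
Variable R : realType.
Implicit Types (F E : R[i] -> R[i]) (z : R[i]).

(* e^(x + iy) = e^x (cos y + i sin y) *)
Definition cexp z : R[i] :=
  (expR (complex.Re z))%:C%C * Complex (cos (complex.Im z)) (sin (complex.Im z)).

(* The field of scalars is R[i], so this is complex differentiability. *)
Definition entire F : Prop :=
  forall z, derivable (F : R[i]^o -> R[i]^o) z 1.

Definition sharp F : R[i] -> R[i] := fun z => (F z^*)^*.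

Definition HB_class E : Prop :=
  [/\ entire E,
      forall x : R, E x%:C%C != 0 &
      forall z, 0 < complex.Im z -> `|sharp E z| < `|E z|].

End EntireFunctions.

Section RealMatrices.
Variable R : realType.
Local Notation mu := (@lebesgue_measure R).

Definition mx2 (a b c d : R) : 'M[R]_2 :=
  \matrix_(i < 2, j < 2) nth 0 (nth [::] [:: [:: a; b]; [:: c; d]] i) j.

Definition quad_form (n : nat) (A : 'M[R]_n) (v : 'cV[R]_n) : R :=
  (v^T *m A *m v) 0 0.

Definition posdefmx (n : nat) (A : 'M[R]_n) : Prop :=
  A^T = A /\ forall v : 'cV[R]_n, v != 0 -> 0 < quad_form A v.

Definition possemidefmx (n : nat) (A : 'M[R]_n) : Prop :=
  A^T = A /\ forall v : 'cV[R]_n, 0 <= quad_form A v.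

(* The quasi-canonical system -d/dt (A, B)^T = z J H(t) (A, B)^T on [0, l[ is
   determined by l and H, so being a canonical system is a condition on them. *)
Definition canonical_system (l : R) (H : R -> 'M[R]_2) : Prop :=
  [/\ {ae mu, forall t, t \in `[0, l[ -> possemidefmx (H t)},
      forall A : set R, measurable A -> A `<=` `[0, l[ ->
        (0 < mu A)%E -> ~ (forall t, A t -> H t = 0) &
      forall (K : set R) (i j : 'I_2), compact K -> K `<=` `[0, l[ ->
        mu.-integrable K (fun t => (H t i j)%:E)].

End RealMatrices.

Definition freqL (d : nat) : nat := if odd d then d else d./2.
Definition freqr (d : nat) : nat := if odd d then 2 else 1.

(* The tuple C = (C_L, C_(L-r), ..., C_(-L)) is indexed so that
   C`_j = C_(L - r j) for 0 <= j <= d; since r d = 2 L, this also gives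
   C_(-(L - r j)) = C_(-L + r j) = C`_(d - j). *)
Section ExponentialPolynomial.
Variables (R : realType) (d : nat) (C : d.+1.-tuple R[i]).

Definition exp_poly (z : R[i]) : R[i] :=
  \sum_(j < d.+1)
    C`_j * cexp ('i * ((freqL d)%:Z - (freqr d * j)%N%:Z)%:~R * z).

Definition fpoly : {poly R[i]} :=
  \sum_(j < d.+1) C`_(d - j) *: 'X^(d - j).

Definition toepM (n : nat) : 'M[R[i]]_n :=
  \matrix_(j < n, k < n) if (j <= k)%N then C`_(d - (k - j)) else 0.

Definition toepN (n : nat) : 'M[R[i]]_n :=
  \matrix_(j < n, k < n) if (j <= k)%N then C`_(k - j) else 0.

(* In what follows s is the sign: s = 1 for +, s = -1 for -. *)
Definition Lmx (s : R[i]) (n : nat) : 'M[R[i]]_(n + n) :=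
  block_mx (toepM n)^T (s *: (map_mx Num.conj (toepN n))^T)
           (s *: toepN n) (map_mx Num.conj (toepM n)).

Definition Ddet (n : nat) : R[i] := \det (Lmx 1 n).

(* (z(1), ..., z(n), conj z(n), ..., conj z(1))^T *)
Definition conj_ext (n : nat) (z : 'cV[R[i]]_n) : 'cV[R[i]]_(n + n) :=
  col_mx z (\col_(k < n) (z (rev_ord k) 0)^*).

Definition rhs (n : nat) : 'cV[R[i]]_(n + n) :=
  col_mx (\col_(k < n) if k.+1 == n then 2 * (C`_0)^* else 0)
         (\col_(k < n) if k == 0%N :> nat then 2 * C`_0 else 0).

Definition is_zsol (s : R[i]) (n : nat) (z : 'cV[R[i]]_n) : Prop :=
  Lmx s n *m conj_ext z = - s *: rhs n.

Definition zsol (s : R[i]) (n : nat) : 'cV[R[i]]_n :=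
  xget 0 [set z | is_zsol s z].

Definition Zmx (n : nat) : 'M[R]_2 :=
  if n is m.+1 then
    let zp := zsol 1 m.+1 0 0 in
    let zm := zsol (-1) m.+1 0 0 in
    mx2 (complex.Re zp) (complex.Im zp) (- complex.Im zm) (complex.Re zm)
  else 1%:M.

Fixpoint Zprod (n : nat) : 'M[R]_2 :=
  if n is m.+1 then Zmx n *m Zprod m else 1%:M.

Definition is_Hmx (n : nat) (H : 'M[R]_2) : Prop :=
  H^T = H /\
  Zprod n *m mx2 0 (-1) 1 0 *m H = mx2 0 1 (-1) 0 *m Zprod n.

Definition Hmx (n : nat) : 'M[R]_2 := xget 0 [set H | is_Hmx n H].

Definition hamiltonian (t : R) : 'M[R]_2 :=
  \sum_(1 <= n < d.+1 |
        ((freqr d)%:R * n.-1%:R / 2 <= t) && (t < (freqr d)%:R * n%:R / 2))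
    Hmx n.

(* zsol and Hmx take the value 0 when there is no solution and pick one when
   there are several; they are meaningful exactly under this condition. *)
Definition hamiltonian_well_defined : Prop :=
  forall n : nat, (1 <= n <= d)%N ->
    [/\ exists! z : 'cV[R[i]]_n, is_zsol 1 z,
        exists! z : 'cV[R[i]]_n, is_zsol (-1) z &
        exists! H : 'M[R]_2, is_Hmx n H].

End ExponentialPolynomial.

(* Main.v *)
Require Import Defs.
From HB Require Import structures.
From mathcomp Require Import all_boot all_order all_algebra complex.
From mathcomp Require Import all_classical all_reals all_analysis.
From mathcomp Require Import ring.
Import Order.TTheory GRing.Theory Num.Theory.
Import numFieldNormedType.Exports.
Local Open Scope classical_set_scope.
Local Open Scope ring_scope.
Set Implicit Arguments.
Unset Strict Implicit.
Unset Printing Implicit Defensive.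

(** Write c_k for the entry of index k of C, f = c_0 + c_1 T + ... + c_d T^d,
    and let f* be the reciprocal polynomial, whose coefficient of index k is the
    conjugate of c_(d-k).

    Roots and the Hermite-Biehler class. With w = e^(-irz) one has
    E(z) = e^(iLz) f(w) and E#(z) = e^(iLz) f*(w), since e^(2iLz) w^d = 1. The
    upper half plane is mapped onto |w| > 1 and the real line onto |w| = 1, so
    E is in the class exactly when f has no zero on the unit circle and
    |f*| < |f| outside of it. If all roots a of f are in the open disk this
    holds factor by factor, because |1 - a^* w| < |w - a| ([blaschke_lt]); a
    root outside would be a zero of E where |E#| < |E| or on the real line.

    Roots and determinants. Let P and N be the upper triangular Toeplitz
    matrices of size n of f* and f, and S_n = P P^* - N N^*. Because triangular
    Toeplitz matrices commute, D_n = det S_n ([det_toep_block]). S_n is the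
    lower right block of S_(n+1), so by Sylvester's criterion ([sylvester]) the
    D_n are all positive if and only if S_d is positive definite. Reading a row
    vector as a polynomial V, the value of the form S_n at V is the sum of the
    squared moduli of the first n coefficients of V f* minus the same sum for
    V f. When f = (T - a) h this form is the one of h, up to the change of
    variable V -> (1 - a^* T) V, plus (1 - |a|^2) times a square
    ([schur_form_cons]). An induction on the roots then gives Schur's criterion
    ([schur_form_definite], [schur_form_root]).

    Determinants and the Hamiltonian. If S_n is invertible, let y be the first
    row of its inverse and alpha_n its first entry, that is D_(n-1) / D_n. A
    change of sign in half of the unknowns turns the system of sign - into the
    one of sign + with another right-hand side; comparing the solutions shows
    that det Z_n only involves alpha_n and |beta_n|^2, where beta_n is the
    last entry of y P ([cross_term]). One step of the Levinson recursion, which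
    produces the first row of the inverse of S_(n-1) from that of S_n, expresses
    |beta_n|^2 by alpha_n and alpha_(n-1) ([levinson]), and one finds
    det Z_1 = - 4 |c_0|^2 alpha_1 and det Z_n = 4 |c_0|^4 alpha_n alpha_(n-1)
    for n > 1. In the product Z_n ... Z_1 all the alpha_k with k < n occur
    squared, so that its determinant is - alpha_n times a positive number
    ([det_Zprod]). Finally H_n = - (det Q)^-1 Q^T Q with Q = Z_n ... Z_1, which
    is positive definite exactly when det Q < 0, that is alpha_n > 0; and
    alpha_n > 0 for all n means that all D_n are positive. *)

(** * The Schur form of a polynomial given by its roots *)

Section SchurForm.
Variable K : numClosedFieldType.
Implicit Types (a : K) (s : seq K) (h V W w : {poly K}).

Definition coefsq n h : K := \sum_(k < n) `|h`_k| ^+ 2.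

Definition monic_of s : {poly K} := \prod_(a <- s) ('X - a%:P).
Definition recip_of s : {poly K} := \prod_(a <- s) (1 - a^* *: 'X).

(** For f = [monic_of s] this is the Hermitian form of the Schur-Cohn matrix of
    size n, with the vector of coefficients of V as argument. *)
Definition schur_form n s V : K :=
  coefsq n (V * recip_of s) - coefsq n (V * monic_of s).

Lemma coef_recip_factor a h k :
  ((1 - a^* *: 'X) * h)`_k = h`_k - (if k is k'.+1 then a^* * h`_k' else 0).
Proof.
rewrite mulrBl mul1r coefB -scalerAl coefZ coefXM.
by case: k => [|k] //=; rewrite mulr0.
Qed.

Lemma coef_factor a h k :
  (('X - a%:P) * h)`_k = (if k is k'.+1 then h`_k' else 0) - a * h`_k.
Proof. by rewrite mulrBl coefB coefXM coefCM; case: k. Qed.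

(** T - a and 1 - a^* T have the same modulus on the unit circle, so the full
    sums of squares of both products agree; truncating after n + 1 coefficients
    leaves one boundary term. *)
Lemma coefsq_factor n a h :
  coefsq n.+1 ((1 - a^* *: 'X) * h) =
    coefsq n.+1 (('X - a%:P) * h) + (1 - `|a| ^+ 2) * `|h`_n| ^+ 2.
Proof.
elim: n => [|n IHn].
  rewrite /coefsq !big_ord_recl !big_ord0 !addr0 /= coef_recip_factor.
  rewrite coef_factor /= subr0 sub0r normrN normrM exprMn; ring.
rewrite /coefsq big_ord_recr /= -/(coefsq _ _) IHn.
rewrite [in RHS]big_ord_recr /= -/(coefsq _ _) -!addrA; congr (_ + _).
rewrite coef_recip_factor coef_factor !normCK !rmorphB !rmorphM /= conjCK.
ring.
Qed.

Lemma eq_coefsq n h h' : (forall k, (k < n)%N -> h`_k = h'`_k) ->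
  coefsq n h = coefsq n h'.
Proof. by move=> e; apply: eq_bigr => k _; rewrite e. Qed.

Lemma coefsq_mulX n h : coefsq n.+1 ('X * h) = coefsq n h.
Proof.
rewrite /coefsq big_ord_recl coefXM /= normr0 expr0n add0r.
by apply: eq_bigr => i _; rewrite coefXM.
Qed.

Lemma coefsqZ n a h : coefsq n (a *: h) = `|a| ^+ 2 * coefsq n h.
Proof.
by rewrite mulr_sumr; apply: eq_bigr => i _; rewrite coefZ normrM exprMn.
Qed.

Lemma eq_schur_form n s V W : (forall k, (k < n)%N -> V`_k = W`_k) ->
  schur_form n s V = schur_form n s W.
Proof.
move=> e; congr (_ - _); apply: eq_coefsq => k kn; rewrite !coefM.
  by apply: eq_bigr => i _; rewrite e // (leq_ltn_trans _ kn) // -ltnS.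
by apply: eq_bigr => i _; rewrite e // (leq_ltn_trans _ kn) // -ltnS.
Qed.

Lemma schur_form_mulX n s V : schur_form n.+1 s ('X * V) = schur_form n s V.
Proof. by rewrite /schur_form -!mulrA !coefsq_mulX. Qed.

(** The step of the induction on the roots; the sign of the extra square says on
    which side of the unit circle a lies. *)
Lemma schur_form_cons n a s V :
  schur_form n.+1 (a :: s) V = schur_form n.+1 s ((1 - a^* *: 'X) * V)
    + (1 - `|a| ^+ 2) * `|(V * monic_of s)`_n| ^+ 2.
Proof.
rewrite /schur_form /recip_of /monic_of !big_cons -/(recip_of s) -/(monic_of s).
have -> : V * (('X - a%:P) * monic_of s) = ('X - a%:P) * (V * monic_of s)
  by ring.
have := coefsq_factor n a (V * monic_of s).
rewrite !mulrA [V * (1 - _)]mulrC => ->; ring.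
Qed.

Lemma size_monic_of s : size (monic_of s) = (size s).+1.
Proof. exact: size_prod_XsubC. Qed.

(** The form has a radical: when n exceeds the number of roots, the low degree
    part of V is invisible, since f and f* have the same modulus on the unit
    circle and nothing is truncated. *)
Lemma schur_form_low n s V w : (size w + size s <= n)%N ->
  schur_form n s (V + w) = schur_form n s V.
Proof.
elim: s n V w => [|a s IHs] n V w.
  by rewrite /schur_form /recip_of /monic_of !big_nil !subrr.
case: n => [|n]; first by rewrite /schur_form /coefsq !big_ord0.
rewrite /= addnS ltnS => le_n; rewrite !schur_form_cons mulrDr IHs; last first.
  apply: (@leq_trans ((size w).+1 + size s)); last by rewrite addSn.
  rewrite leq_add2r; apply/leq_sizeP => -[//|k] lek.
  by rewrite coef_recip_factor !nth_default ?mulr0 ?subr0 // ltnW.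
congr (_ + _ * `|_| ^+ 2).
rewrite mulrDl coefD [X in _ + X]nth_default ?addr0 //.
by apply: leq_trans (size_polyMleq _ _) _; rewrite size_monic_of addnS.
Qed.

Lemma size_recip_of s : (size (recip_of s) <= (size s).+1)%N.
Proof.
elim: s => [|a s IHs]; first by rewrite /recip_of big_nil size_poly1.
apply/leq_sizeP => -[//|k] lek; rewrite /recip_of big_cons -/(recip_of s).
by rewrite coef_recip_factor !(leq_sizeP _ _ IHs) ?mulr0 ?subr0 // ltnW.
Qed.

Lemma recip_of_coef s k : (k <= size s)%N ->
  (recip_of s)`_k = ((monic_of s)`_(size s - k))^*.
Proof.
elim: s k => [|a s IHs] k.
  by rewrite leqn0 => /eqP->; rewrite /recip_of /monic_of !big_nil !coef1
    rmorph_nat.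
rewrite /recip_of /monic_of !big_cons -/(recip_of s) -/(monic_of s) /=.
move=> le_k; rewrite coef_recip_factor coef_factor rmorphB rmorphM /=.
case: k le_k => [|k] le_k.
  rewrite subn0 IHs // subn0 [(monic_of s)`_(size s).+1]nth_default
    ?size_monic_of //.
  by rewrite rmorph0 mulr0.
rewrite subSS; have [lt_k | ge_k] := ltnP k (size s).
  by rewrite !IHs ?(ltnW lt_k) // -(subnSK lt_k).
have -> : k = size s by apply/eqP; rewrite eqn_leq ge_k -ltnS le_k.
rewrite subnn nth_default ?size_recip_of // [(recip_of s)`_(size s)]IHs //.
by rewrite subnn !sub0r rmorph0 sub0r.
Qed.

Lemma schur_form_ge0 n s V : all (fun a => `|a| < 1) s ->
  0 <= schur_form n s V.
Proof.
elim: s V => [|a s IHs] V.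
  by rewrite /schur_form /recip_of /monic_of !big_nil subrr.
case: n IHs => [|n] IHs /= /andP[a1 s1].
  by rewrite /schur_form /coefsq !big_ord0 subrr.
rewrite schur_form_cons addr_ge0 ?IHs // mulr_ge0 ?exprn_ge0 //.
by rewrite subr_ge0 exprn_ile1 // ltW.
Qed.

Lemma recip_of_neq0 s a : all (fun b => `|b| < 1) s -> `|a| < 1 ->
  (recip_of s).[a] != 0.
Proof.
move=> s1 a1; rewrite /recip_of horner_prod prodf_seq_neq0.
apply: sub_all s1 => b b1 /=; rewrite !hornerE subr_eq0 eq_sym.
apply: contraTneq isT => e; have: `|b^* * a| < 1.
  by rewrite normrM norm_conjC mulr_ilt1.
by rewrite e normr1 ltxx.
Qed.

(** Peel off the first root a. If n is at most the number of the others, the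
    induction hypothesis applies to W = (1 - a^* T) V. Otherwise it applies to W
    deprived of its constant term, by [schur_form_low]. This makes V a multiple
    of the expansion of 1 / (1 - a^* T), and the last square is then, up to
    |V(0)|^2, the squared modulus of the value at a of the reciprocal polynomial
    of the other factors, which has no zero in the disk. *)
Lemma schur_form_definite n s V : all (fun a => `|a| < 1) s ->
  (n <= size s)%N -> schur_form n s V <= 0 ->
  forall k, (k < n)%N -> V`_k = 0.
Proof.
elim: s n V => [|a s IHs] [//|n] V //= /andP[a1 s1] le_n.
have a2 : 0 < 1 - `|a| ^+ 2 by rewrite subr_gt0 exprn_ilt1.
rewrite schur_form_cons; set W := (_ * V) => le0.
have ge1 := schur_form_ge0 n.+1 W s1.
have ge2 : 0 <= (1 - `|a| ^+ 2) * `|(V * monic_of s)`_n| ^+ 2.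
  by rewrite mulr_ge0 ?exprn_ge0 // ltW.
have W0 : schur_form n.+1 s W <= 0 by apply: le_trans le0; rewrite lerDl.
have coefV k : (0 < k)%N -> W`_k = 0 -> V`_k = a^* * V`_k.-1.
  by case: k => // k _; rewrite coef_recip_factor => /subr0_eq.
have V00 : W`_0 = V`_0 by rewrite coef_recip_factor subr0.
have [lt_n | ge_n] := ltnP n (size s).
  have {}W0 := IHs _ _ s1 lt_n W0.
  elim=> [|k IHk] lt_k; first by rewrite -V00 W0.
  by rewrite coefV ?W0 //= IHk ?mulr0 // ltnW.
have {le_n ge_n} nE : n = size s by apply/eqP; rewrite eqn_leq ge_n -ltnS le_n.
have {}W0 k : (0 < k < n.+1)%N -> W`_k = 0.
  case: k => // k; rewrite ltnS => lt_k.
  have -> : W`_k.+1 = (drop_poly 1 W)`_k by rewrite coef_drop_poly addn1.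
  apply: (IHs n _ s1) => //; first by rewrite nE.
  rewrite -schur_form_mulX -(@schur_form_low _ _ _ (W`_0)%:P); last first.
    by rewrite (leq_trans (leq_add (size_polyC_leq1 _) (leqnn _))) // nE.
  suff -> : 'X * drop_poly 1 W + (W`_0)%:P = W by [].
  apply/polyP => -[|i]; rewrite coefD coefXM coefC ?add0r //=.
  by rewrite addr0 coef_drop_poly addn1.
have VE k : (k < n.+1)%N -> V`_k = a^* ^+ k * V`_0.
  elim: k => [|k IHk] lt_k; first by rewrite mul1r.
  by rewrite coefV ?W0 //= IHk ?(ltnW lt_k) // exprS mulrA.
suff V0 : V`_0 = 0 by move=> k /VE->; rewrite V0 mulr0.
have : (V * monic_of s)`_n = 0.
  apply/eqP; rewrite -normr_eq0 -sqrf_eq0 -(mulrI_eq0 _ (mulfI (lt0r_neq0 a2))).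
  by rewrite eq_le ge2 (le_trans _ le0) // lerDr.
have -> : (V * monic_of s)`_n = V`_0 * ((recip_of s).[a])^*.
  rewrite (horner_coef_wide _ (size_recip_of s)) rmorph_sum mulr_sumr coefM nE.
  apply: eq_bigr => i _; rewrite VE; last by rewrite nE.
  rewrite recip_of_coef -1?ltnS ?ltn_ord // rmorphM /= conjCK rmorphXn /=.
  ring.
move/eqP; rewrite mulf_eq0 conjC_eq0 (negPf (recip_of_neq0 s1 a1)) orbF.
by move/eqP.
Qed.

(** With a in front, the expansion of 1 / (1 - a^* T) turns W into the constant
    1 modulo T^(size s), which lies in the radical of the form of the remaining
    factors. *)
Lemma schur_form_root s a : a \in s -> 1 <= `|a| ->
  exists2 V : {poly K}, V`_0 = 1 & schur_form (size s) s V <= 0.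
Proof.
move=> a_s a1; pose n := (size (rem a s)).
have sz : size s = n.+1 by rewrite /n size_rem // prednK // lt0n size_eq0;
  apply: contraTneq a_s => ->.
exists (\poly_(k < n.+1) (a^* ^+ k)); first by rewrite coef_poly.
set V := \poly_(k < _) _.
have -> : schur_form (size s) s V = schur_form n.+1 (a :: rem a s) V.
  by rewrite sz /schur_form /monic_of /recip_of !(perm_big _ (perm_to_rem a_s)).
rewrite schur_form_cons (@eq_schur_form _ _ _ (0 + 1)); last first.
  move=> k lt_k; rewrite coef_recip_factor add0r coef1 coef_poly lt_k.
  case: k lt_k => [|k] lt_k; first by rewrite subr0.
  by rewrite coef_poly (ltnW lt_k) exprS subrr.
rewrite schur_form_low ?size_poly1 // /schur_form !mul0r !subrr add0r.
rewrite mulr_le0_ge0 ?exprn_ge0 // subr_le0 exprn_ege1 //.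
Qed.

End SchurForm.

(** * Positive definiteness of nested Hermitian matrices *)

Section Sylvester.
Variable K : numClosedFieldType.

(** The conjugate transpose, in the form in which the coefficients of the block
    matrices are given. *)
Definition ctr m n (A : 'M[K]_(m, n)) : 'M[K]_(n, m) := (map_mx Num.conj A)^T.

Definition qf n (A : 'M[K]_n) (v : 'rV[K]_n) : K := (v *m A *m ctr v) 0 0.

Definition pos_form n (A : 'M[K]_n) := forall v, v != 0 -> 0 < qf A v.

Lemma ctrE m n (A : 'M[K]_(m, n)) i j : ctr A i j = (A j i)^*.
Proof. by rewrite !mxE. Qed.

Lemma ctrM m n p (A : 'M[K]_(m, n)) (B : 'M[K]_(n, p)) :
  ctr (A *m B) = ctr B *m ctr A.
Proof. by rewrite /ctr map_mxM trmx_mul. Qed.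

Lemma ctrK m n (A : 'M[K]_(m, n)) : ctr (ctr A) = A.
Proof. by apply/matrixP => i j; rewrite !ctrE conjCK. Qed.

Lemma ctrD m n (A B : 'M[K]_(m, n)) : ctr (A + B) = ctr A + ctr B.
Proof. by apply/matrixP => i j; rewrite !mxE rmorphD. Qed.

Lemma ctrZ m n a (A : 'M[K]_(m, n)) : ctr (a *: A) = a^* *: ctr A.
Proof. by apply/matrixP => i j; rewrite !mxE rmorphM. Qed.

Lemma ctr_delta m n i j : ctr (delta_mx i j : 'M[K]_(m, n)) = delta_mx j i.
Proof. by apply/matrixP => k l; rewrite ctrE !mxE andbC rmorph_nat. Qed.

Lemma invmx00 n (A : 'M[K]_n.+1) : A \in unitmx ->
  invmx A 0 0 = \det (row' 0 (col' 0 A)) / \det A.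
Proof.
by move=> uA; rewrite /invmx uA !mxE /cofactor addn0 expr0 mul1r mulrC.
Qed.

Lemma qf_row'_col' n (A : 'M[K]_n.+1) (w : 'rV[K]_n.+1) : w 0 0 = 0 ->
  qf A w = qf (row' 0 (col' 0 A)) (\row_k w 0 (lift 0 k)).
Proof.
move=> w0; rewrite /qf !mxE big_ord_recl !mxE w0 rmorph0 mulr0 add0r.
apply: eq_bigr => k _; rewrite !mxE; congr (_ * _).
rewrite big_ord_recl w0 mul0r add0r.
by apply: eq_bigr => l _; rewrite !mxE.
Qed.

Lemma pos_form_minor n (A : 'M[K]_n.+1) :
  pos_form A -> pos_form (row' 0 (col' 0 A)).
Proof.
move=> posA v v0.
pose w : 'rV[K]_n.+1 := \row_k if unlift 0 k is Some l then v 0 l else 0.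
have wE k : w 0 (lift 0 k) = v 0 k by rewrite mxE liftK.
have -> : v = \row_k w 0 (lift 0 k) by apply/rowP => k; rewrite mxE wE.
rewrite -qf_row'_col' ?mxE ?unlift_none //; apply: posA.
apply: contraNneq v0 => w0; apply/eqP/rowP => k.
by rewrite -wE w0 !mxE.
Qed.

Lemma pos_form_unit n (A : 'M[K]_n) : pos_form A -> A \in unitmx.
Proof.
move=> posA; rewrite unitmxE unitfE; apply/negP => /det0P[v v0 vA].
by have := posA v v0; rewrite /qf vA mul0mx mxE ltxx.
Qed.

(** The first row y of the inverse of A is orthogonal, for the form A, to all
    vectors with first entry 0, and its square is the first entry of y. *)
Lemma qf_split n (A : 'M[K]_n.+1) t (w : 'rV[K]_n.+1) :
    ctr A = A -> A \in unitmx -> w 0 0 = 0 ->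
  qf A (t *: row 0 (invmx A) + w) = `|t| ^+ 2 * (invmx A 0 0)^* + qf A w.
Proof.
move=> hA uA w0; rewrite /qf; set y := row 0 _.
have yA : y *m A = delta_mx 0 0.
  by rewrite /y -row_mul mulVmx // rowE mulmx1.
have Ay : A *m ctr y = delta_mx 0 0 by rewrite -[A]hA -ctrM yA ctr_delta.
have e0w : (delta_mx 0 0 : 'rV_n.+1) *m ctr w = 0 :> 'M[K]_1.
  by rewrite -rowE; apply/matrixP => i j; rewrite !mxE !ord1 w0 rmorph0.
have we0 : w *m (delta_mx 0 0 : 'cV_n.+1) = 0 :> 'M[K]_1.
  by rewrite -colE; apply/matrixP => i j; rewrite !mxE !ord1 w0.
have e0y : ((delta_mx 0 0 : 'rV_n.+1) *m ctr y) 0 0 = (invmx A 0 0)^*.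
  by rewrite -rowE mxE ctrE mxE.
rewrite mulmxDl ctrD mulmxDr !mulmxDl -!scalemxAl yA ctrZ -!scalemxAr.
rewrite -(mulmxA w A (ctr y)) Ay we0 e0w !scaler0 add0r addr0 mxE;
  congr (_ + _).
by rewrite mxE mxE e0y normCK; ring.
Qed.

(** Split v along the first row of the inverse and the vectors with first entry
    0, as in [qf_split]. *)
Lemma pos_form_extend n (A : 'M[K]_n.+1) : ctr A = A -> A \in unitmx ->
  pos_form (row' 0 (col' 0 A)) -> 0 < invmx A 0 0 -> pos_form A.
Proof.
move=> hA uA pos' pos0 v v0; set y := row 0 (invmx A).
have y00 : y 0 0 = invmx A 0 0 by rewrite mxE.
pose t := v 0 0 / y 0 0; pose w := v - t *: y.
have w0 : w 0 0 = 0 by rewrite !mxE /t y00 divfK ?subrr // gt_eqF.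
have vE : v = t *: y + w by rewrite /w addrC subrK.
rewrite vE qf_split // geC0_conj ?(ltW pos0) //.
have [w'0|w'0] := eqVneq (\row_k w 0 (lift 0 k)) 0.
  have w00 : w = 0.
    apply/rowP => k; rewrite [RHS]mxE; have [l ->|-> //] := unliftP 0 k.
    by move/rowP/(_ l): w'0; rewrite !mxE.
  rewrite w00 /qf !mul0mx mxE addr0 mulr_gt0 // exprn_gt0 // normr_gt0.
  by apply: contraNneq v0 => t0; rewrite vE w00 t0 scale0r addr0.
rewrite ltr_wpDl ?mulr_ge0 ?exprn_ge0 ?(ltW pos0) //.
by rewrite qf_row'_col' //; apply: pos'.
Qed.

Variable S : forall n, 'M[K]_n.
Hypothesis S_hermitian : forall n, ctr (S n) = S n.
Hypothesis S_nested : forall n, row' 0 (col' 0 (S n.+1)) = S n.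

(** The ratio of consecutive determinants is the first entry of the inverse, so
    both directions follow by adding one row and one column at a time. *)
Lemma sylvester d :
  (forall n, (0 < n <= d)%N -> 0 < \det (S n)) <-> pos_form (S d).
Proof.
elim: d => [|d IHd].
  split=> [_ v|_ [|//]//].
  by rewrite [v]thinmx0 eqxx.
split=> [pos|pos].
  have uS : S d.+1 \in unitmx.
    by rewrite unitmxE unitfE gt_eqF // pos // leqnn.
  apply: pos_form_extend => //.
    by rewrite S_nested; apply/IHd => n /andP[n0 le_n]; rewrite pos // n0 leqW.
  rewrite invmx00 // S_nested divr_gt0 //; last by rewrite pos // leqnn.
  by case: d {IHd uS} pos => [|d] pos; rewrite ?det_mx00 // pos //= leqW.
have pos' : pos_form (S d) by rewrite -S_nested; apply: pos_form_minor.
move/IHd: (pos') => IH n /andP[n0]; rewrite leq_eqVlt => /orP[/eqP->|];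
  last first.
  by rewrite ltnS => le_n; apply: IH; rewrite n0.
have uS := pos_form_unit pos; have hS := S_hermitian d.+1.
have pd : 0 < \det (S d).
  by case: d {IHd pos pos' uS hS} IH => [|d] IH;
    rewrite ?det_mx00 // IH //= leqnn.
have invC_gt0 (x : K) : 0 < x^* -> 0 < x.
  by rewrite !lt_def conjC_eq0 conjC_ge0.
set y := row 0 (invmx (S d.+1)); have y0 : y != 0.
  apply: contraTneq isT => y0.
  have := mulVmx uS => /(congr1 (row 0)); rewrite row_mul -/y y0 mul0mx.
  by move/rowP/(_ 0)/eqP; rewrite !mxE eqxx eq_sym oner_eq0.
have := pos _ y0; rewrite -[y]addr0 -{1}[y]scale1r qf_split ?mxE //.
rewrite /qf !mul0mx mxE addr0 normr1 expr1n mul1r.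
rewrite invmx00 // S_nested => /invC_gt0.
by rewrite pmulr_rgt0 // invr_gt0.
Qed.
End Sylvester.

(** * Toeplitz matrices and the Schur matrix *)

Section Toeplitz.
Variable K : numClosedFieldType.
Implicit Types (f g h : {poly K}).

Definition toep n h : 'M[K]_n :=
  \matrix_(j < n, k < n) if (j <= k)%N then h`_(k - j) else 0.

(** Multiplying a row vector by an upper triangular Toeplitz matrix is
    multiplying polynomials modulo T^n. *)
Lemma coef_rVpolyM n (v : 'rV[K]_n) h (k : 'I_n) :
  (v *m toep n h) 0 k = (rVpoly v * h)`_k.
Proof.
rewrite mxE coefM (big_ord_widen_cond n xpredT (fun j => (rVpoly v)`_j * h`_(k
  - j))) //.
rewrite [RHS]big_mkcond; apply: eq_bigr => j _ /=.
by rewrite coef_rVpoly_ord mxE ltnS; case: ifP => // _; rewrite mulr0.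
Qed.

Lemma toep_mul n g h : toep n g *m toep n h = toep n (g * h).
Proof.
apply/matrixP => j k.
have -> : (toep n g *m toep n h) j k = (row j (toep n g) *m toep n h) 0 k.
  by rewrite -row_mul [RHS]mxE.
rewrite coef_rVpolyM; have -> : toep n (g * h) j k = ('X^j * (g * h))`_k.
  by rewrite mxE coefXnM ltnNge; case: leqP.
rewrite mulrA !coefM; apply: eq_bigr => i _; congr (_ * _).
have lt_i : (i < n)%N by apply: leq_trans (ltn_ord k); rewrite ltnS -ltnS.
rewrite -[val i]/(val (Ordinal lt_i)) coef_rVpoly_ord !mxE coefXnM ltnNge.
by case: leqP.
Qed.

Lemma toep_comm n g h : toep n g *m toep n h = toep n h *m toep n g.
Proof. by rewrite !toep_mul mulrC. Qed.

Lemma det_toep n h : \det (toep n h) = h`_0 ^+ n.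
Proof.
rewrite -det_tr det_trig.
  rewrite (eq_bigr (fun=> h`_0)) ?prodr_const ?card_ord // => i _.
  by rewrite !mxE leqnn subnn.
by apply/is_trig_mxP => i j lt_ij; rewrite !mxE leqNgt lt_ij.
Qed.

Lemma unit_toep n h : h`_0 != 0 -> toep n h \in unitmx.
Proof. by move=> h0; rewrite unitmxE det_toep unitrX // unitfE. Qed.

(** The Schur-Cohn matrix when g is the reciprocal polynomial of f. *)
Definition schur_mx n f g : 'M[K]_n :=
  toep n g *m ctr (toep n g) - toep n f *m ctr (toep n f).

Lemma ctr_schur_mx n f g : ctr (schur_mx n f g) = schur_mx n f g.
Proof.
rewrite /schur_mx -scaleN1r ctrD ctrZ !ctrM !ctrK.
by rewrite rmorphN rmorph1.
Qed.

Lemma schur_mx_nested n f g :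
  row' 0 (col' 0 (schur_mx n.+1 f g)) = schur_mx n f g.
Proof.
apply/matrixP => j k; rewrite !mxE; congr (_ - _).
  by rewrite big_ord_recl !mxE /= mul0r add0r; apply: eq_bigr => l _;
    rewrite !mxE.
by rewrite big_ord_recl !mxE /= mul0r add0r; apply: eq_bigr => l _;
  rewrite !mxE.
Qed.

Lemma qf_schur_mx n f g (v : 'rV_n) :
  qf (schur_mx n f g) v = coefsq n (rVpoly v * g) - coefsq n (rVpoly v * f).
Proof.
have aux h : (v *m (toep n h *m ctr (toep n h)) *m ctr v) 0 0
    = coefsq n (rVpoly v * h).
  rewrite !mulmxA -mulmxA -ctrM mxE; apply: eq_bigr => k _.
  by rewrite ctrE -normCK coef_rVpolyM.
by rewrite /qf mulmxBr mulmxBl !mxE -!aux !mxE.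
Qed.

(** Schur's criterion: both implications are read off from the Schur form. *)
Lemma schur_criterion (s : seq K) c : c != 0 ->
  pos_form (schur_mx (size s) (c *: monic_of s) (c^* *: recip_of s)) <->
  (forall a, a \in s -> `|a| < 1).
Proof.
move=> c0; set A := schur_mx _ _ _.
have qfE v : qf A v = `|c| ^+ 2 * schur_form (size s) s (rVpoly v).
  by rewrite qf_schur_mx -!scalerAr !coefsqZ norm_conjC -mulrBr.
have c2 : 0 < `|c| ^+ 2 by rewrite exprn_gt0 ?normr_gt0.
split=> [pos a a_s|s1 v v0].
  rewrite real_ltNge ?realE ?normr_ge0 ?ler01 //; apply/negP => a1.
  have [V V0 V_le0] := schur_form_root a_s a1.
  have s0 : (0 < size s)%N by case: s a_s {A qfE pos V_le0}.
  have : 0 < qf A (poly_rV V).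
    apply: pos; apply: contraTneq isT => v0.
    have := coef_rVpoly_ord (poly_rV V) (Ordinal s0); rewrite mxE /= V0.
    by rewrite v0 linear0 coef0 => /eqP; rewrite eq_sym oner_eq0.
  rewrite qfE pmulr_rgt0 // (@eq_schur_form _ _ _ _ V) =>
    [/lt_le_trans/(_ V_le0)|].
    by rewrite ltxx.
  move=> k lt_k; rewrite -[k]/(val (Ordinal lt_k)) coef_rVpoly_ord.
  by rewrite mxE.
have all1 : all (fun a => `|a| < 1) s by apply/allP.
rewrite qfE pmulr_rgt0 // lt_def schur_form_ge0 // andbT.
apply: contra v0 => /eqP e; apply/eqP/rowP => k.
rewrite mxE -coef_rVpoly_ord.
by apply: (schur_form_definite all1 (leqnn _)) => //; rewrite e.
Qed.

(** The number alpha of index n + 1. *)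
Definition schur_inv n f g : K := (invmx (schur_mx n.+1 f g)) 0 0.

Lemma schur_invE n f g : schur_mx n.+1 f g \in unitmx ->
  schur_inv n f g = \det (schur_mx n f g) / \det (schur_mx n.+1 f g).
Proof. by move=> uS; rewrite /schur_inv invmx00 // schur_mx_nested. Qed.

Lemma schur_inv_conj n f g : schur_mx n.+1 f g \in unitmx ->
  (schur_inv n f g)^* = schur_inv n f g.
Proof.
move=> uS; rewrite /schur_inv -[LHS]ctrE; congr (fun_of_matrix _ 0 0).
have e : ctr (invmx (schur_mx n.+1 f g)) *m schur_mx n.+1 f g = 1%:M.
  rewrite -{2}[schur_mx _ _ _]ctr_schur_mx -ctrM mulmxV //.
  by rewrite /ctr map_mx1 trmx1.
by rewrite -[LHS]mulmx1 -(mulmxV uS) mulmxA e mul1mx.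
Qed.

End Toeplitz.

(** * The Levinson step and the block Toeplitz systems *)

Section Levinson.
Variables (K : numClosedFieldType) (f g : {poly K}).
Implicit Type h : {poly K}.
Hypotheses (f0 : f`_0 != 0) (g0 : g`_0 != 0).

Definition revmx n : 'M[K]_n := \matrix_(i, j) (i == rev_ord j)%:R.

Lemma mul_revmx m n (A : 'M[K]_(m, n)) i k :
  (A *m revmx n) i k = A i (rev_ord k).
Proof.
rewrite mxE (bigD1 (rev_ord k)) //= mxE eqxx mulr1 big1 ?addr0 // => j ne.
by rewrite mxE (negPf ne) mulr0.
Qed.

Lemma revmx_mul m n (A : 'M[K]_(n, m)) i k :
  (revmx n *m A) i k = A (rev_ord i) k.
Proof.
rewrite mxE (bigD1 (rev_ord i)) //= mxE rev_ordK eqxx mul1r big1 ?addr0 // =>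
  j ne.
by rewrite mxE eq_sym (can2_eq rev_ordK rev_ordK) (negPf ne) mul0r.
Qed.

(** Symmetry about the antidiagonal; it turns transposition into reversal. *)
Lemma toep_persym n h (i k : 'I_n) :
  toep n h (rev_ord i) k = toep n h (rev_ord k) i.
Proof.
rewrite !mxE /=; have := ltn_ord i; have := ltn_ord k => lt_k lt_i.
have -> : (n - i.+1 <= k)%N = (n - k.+1 <= i)%N.
  by rewrite !leq_subLR !addSn addnC.
by case: ifP => // le; congr (_`_ _); rewrite !subnBA // !addnS addnC.
Qed.

Lemma rev_toep n h : revmx n *m toep n h = (toep n h)^T *m revmx n.
Proof.
by apply/matrixP => i k; rewrite revmx_mul mul_revmx [RHS]mxE toep_persym.
Qed.

Lemma rev_ctr_toep n h :
  revmx n *m ctr (toep n h) = map_mx Num.conj (toep n h) *m revmx n.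
Proof.
apply/matrixP => i k; rewrite revmx_mul mul_revmx ctrE [RHS]mxE.
by rewrite -{1}[k]rev_ordK toep_persym rev_ordK.
Qed.

Definition first_row n : 'rV[K]_n.+1 := row 0 (invmx (schur_mx n.+1 f g)).

Lemma first_rowE n : schur_mx n.+1 f g \in unitmx ->
  first_row n *m schur_mx n.+1 f g = delta_mx 0 0.
Proof. by move=> uS; rewrite /first_row -row_mul mulVmx // rowE mulmx1. Qed.

(** The number beta of index n + 1. *)
Definition last_coef n : K := (first_row n *m toep n.+1 g) 0 ord_max.

Lemma delta_toep n h : (delta_mx 0 ord_max : 'rV_n.+1) *m toep n.+1 h =
  h`_0 *: delta_mx 0 ord_max.
Proof.
rewrite -rowE; apply/rowP => k; rewrite !mxE eqxx /=.
have [-> | ne] := eqVneq k ord_max; first by rewrite leqnn subnn mulr1.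
by rewrite mulr0 leqNgt ltn_neqAle ne leq_ord.
Qed.

Lemma mul_toep0 n (v : 'rV[K]_n.+1) h : (v *m toep n.+1 h) 0 0 = v 0 0 * h`_0.
Proof.
rewrite mxE big_ord_recl !mxE /= big1 ?addr0 // => j _.
by rewrite mxE /= mulr0.
Qed.

Lemma mul_ctr_toep_max n (v : 'rV[K]_n.+1) h :
  (v *m ctr (toep n.+1 h)) 0 ord_max = v 0 ord_max * (h`_0)^*.
Proof.
rewrite mxE big_ord_recr /= ctrE mxE leqnn subnn big1 ?add0r // => j _.
by rewrite ctrE mxE /= leqNgt ltn_ord rmorph0 mulr0.
Qed.

(** The upper left block of the Schur matrix of size n + 1 is the one of size n
    up to two rank one terms, whereas by [schur_mx_nested] the lower right block
    is exactly the one of size n. The Levinson step rests on this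
    discrepancy. *)
Lemma schur_mx_displacement n (j k : 'I_n)
    (j' := widen_ord (leqnSn n) j) (k' := widen_ord (leqnSn n) k) :
  schur_mx n f g j k = schur_mx n.+1 f g j' k'
    - toep n.+1 g j' ord_max * (toep n.+1 g k' ord_max)^*
    + toep n.+1 f j' ord_max * (toep n.+1 f k' ord_max)^*.
Proof.
rewrite /schur_mx !mxE !big_ord_recr !ctrE /=.
have aux h : \sum_(i < n) toep n.+1 h j' (widen_ord (leqnSn n) i)
     * ctr (toep n.+1 h) (widen_ord (leqnSn n) i) k'
   = \sum_(i < n) toep n h j i * ctr (toep n h) i k.
  by apply: eq_bigr => i _; rewrite !ctrE !mxE.
rewrite !aux !mxE /=; ring.
Qed.

(** The row G below is the reversal of y, in the sense that its images under P
    and N are, up to the factor g_0 and a unit vector, the reversed conjugates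
    of those of y under N and P; hence G S = e_n N^* with e_n the last unit row.
    The combination W = y + t G whose image under P has last entry 0 satisfies,
    by the displacement formula, that its truncation is the first row of the
    inverse of the smaller matrix. The identity compares first entries. *)
Lemma levinson n :
    schur_mx n.+1 f g \in unitmx -> schur_mx n.+2 f g \in unitmx ->
  `|last_coef n.+1| ^+ 2 =
  `|f`_0| ^+ 2 * (schur_inv n.+1 f g * (schur_inv n.+1 f g - schur_inv n f g)).
Proof.
move=> uS1 uS; set S := schur_mx n.+2 f g.
pose P := toep n.+2 g; pose N := toep n.+2 f; pose J := revmx n.+2.
pose y := first_row n.+1; pose a := schur_inv n.+1 f g.
pose b := (y *m P) 0 ord_max; pose c := (y *m N) 0 ord_max.
have y0 : y 0 0 = a by rewrite mxE.
have ra : a^* = a by apply: schur_inv_conj.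
have a0 : a != 0.
  by rewrite /a schur_invE // mulf_neq0 ?invr_eq0 // -unitfE -unitmxE.
have uP : P \in unitmx by apply: unit_toep.
have yS : y *m S = delta_mx 0 0 by apply: first_rowE.
pose G := g`_0 *: (map_mx Num.conj (y *m N) *m J *m invmx P).
have GP : G *m P = g`_0 *: (map_mx Num.conj (y *m N) *m J).
  by rewrite -scalemxAl mulmxKV.
have GN : G *m N = g`_0 *: (map_mx Num.conj (y *m P) *m J) - delta_mx 0 ord_max.
  have key h : map_mx Num.conj (y *m toep n.+2 h) *m J *m toep n.+2 h =
       map_mx Num.conj (y *m (toep n.+2 h *m ctr (toep n.+2 h))) *m J.
    have -> : toep n.+2 h *m ctr (toep n.+2 h) =
        toep n.+2 h *m map_mx Num.conj (toep n.+2 h)^T by rewrite /ctr map_trmx.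
    rewrite -mulmxA rev_toep mulmxA [in RHS]mulmxA [in RHS]map_mxM.
    rewrite -map_mx_comp [X in _ *m X *m J]map_mx_id.
      by [].
    by move=> x /=; rewrite conjCK.
  have e : map_mx Num.conj (y *m N) *m J *m N =
      map_mx Num.conj (y *m P) *m J *m P - delta_mx 0 ord_max.
    have yPP : y *m (P *m ctr P) = delta_mx 0 0 + y *m (N *m ctr N).
      by rewrite -yS /S /schur_mx mulmxBr subrK.
    have -> : delta_mx 0 ord_max = map_mx Num.conj (delta_mx 0 0) *m J :>
      'rV_n.+2.
      apply/rowP => k; rewrite mul_revmx !mxE !eqxx /= rmorph_nat.
      congr (nat_of_bool _)%:R; rewrite -[k == _](inj_eq rev_ord_inj).
      by congr (_ == _); apply/val_inj; rewrite /= subnn.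
    by rewrite !key yPP map_mxD mulmxDl addrAC subrr add0r.
  rewrite /G -scalemxAl -[_ *m invmx P *m N]mulmxA.
  have -> : invmx P *m N = N *m invmx P.
    by rewrite -{1}[N](mulmxK uP) [N *m P]toep_comm -/P !mulmxA mulVmx //
      mul1mx.
  rewrite mulmxA e mulmxBl mulmxK // scalerBr; congr (_ - _).
  by rewrite scalemxAl -delta_toep mulmxK.
have GS : G *m S = delta_mx 0 ord_max *m ctr N.
  have e : map_mx Num.conj (y *m N) *m J *m ctr P =
           map_mx Num.conj (y *m P) *m J *m ctr N.
    rewrite -!mulmxA !rev_ctr_toep !mulmxA -!map_mxM.
    by rewrite -!mulmxA [N *m P]toep_comm.
  by rewrite /S /schur_mx mulmxBr !mulmxA GP GN mulmxBl -!scalemxAl e subKr.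
(* Last entries in y S = e_0; that of e_0 is 0 as the size is at least 2. *)
have PN : b * (g`_0)^* = c * (f`_0)^*.
  apply/eqP; rewrite -subr_eq0 /b /c -!mul_ctr_toep_max -!mulmxA; apply/eqP.
  have := yS; rewrite /S /schur_mx mulmxBr => /rowP/(_ ord_max).
  by rewrite !mxE.
(* The choice of t that makes the last entry of W P vanish. *)
pose t := - b / (g`_0 * a * (f`_0)^*); pose W := y + t *: G.
have WP : (W *m P) 0 ord_max = 0.
  rewrite mulmxDl -scalemxAl GP mxE -/b [X in _ + X]mxE [X in _ * X]mxE
    mul_revmx.
  have -> : rev_ord (ord_max : 'I_n.+2) = 0 by apply/val_inj; rewrite /= subnn.
  rewrite mxE mul_toep0 y0 rmorphM /= ra /t.
  by field; rewrite conjC_eq0 f0 a0 g0.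
have WN : (W *m N) 0 ord_max = - t.
  rewrite mulmxDl -scalemxAl GN mxE -/c [X in _ + X]mxE [X in _ * X]mxE.
  rewrite [X in _ * (X + _)]mxE mul_revmx.
  have -> : rev_ord (ord_max : 'I_n.+2) = 0 by apply/val_inj; rewrite /= subnn.
  rewrite mxE mul_toep0 y0 !mxE !eqxx rmorphM /= ra.
  have -> : c = b * (g`_0)^* / (f`_0)^* by rewrite PN mulfK // conjC_eq0.
  by rewrite /t; field; rewrite conjC_eq0 f0 a0 g0.
have WS k : (W *m S) 0 k = (k == 0)%:R + t * (N k ord_max)^*.
  by rewrite mulmxDl -scalemxAl yS GS mxE [X in _ + X]mxE -rowE
    [X in _ * X]mxE ctrE mxE.
pose w := \row_(j < n.+1) W 0 (widen_ord (leqnSn _) j).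
have wS : w *m schur_mx n.+1 f g = delta_mx 0 0.
  apply/rowP => k.
  pose k' := widen_ord (leqnSn n.+1) k.
  transitivity ((W *m S) 0 k' - (W *m P) 0 ord_max * (P k' ord_max)^*
    + (W *m N) 0 ord_max * (N k' ord_max)^*); last first.
    by rewrite WS WP WN mul0r subr0 mulNr addrK mxE.
  have Smax : S ord_max k' =
      P ord_max ord_max * (P k' ord_max)^*
      - N ord_max ord_max * (N k' ord_max)^*.
    have aux h : (toep n.+2 h *m ctr (toep n.+2 h)) ord_max k' =
        toep n.+2 h ord_max ord_max * (toep n.+2 h k' ord_max)^*.
      rewrite mxE big_ord_recr /= big1 ?add0r => [|i _].
        by rewrite ctrE.
      by rewrite [toep _ _ _ _]mxE /= leqNgt ltn_ord mul0r.
    by rewrite /S /schur_mx mxE aux [X in _ + X]mxE aux.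
  rewrite [(W *m S) _ _]mxE [(W *m P) _ _]mxE [(W *m N) _ _]mxE.
  rewrite !mulr_suml -sumrB -big_split big_ord_recr /= Smax [LHS]mxE.
  rewrite [X in _ + X](_ : _ = 0) ?addr0; last by ring.
  apply: eq_bigr => i _; rewrite schur_mx_displacement [w _ _]mxE -/S -/P -/N
    -/k'.
  by ring.
have W0 : W 0 0 = schur_inv n f g.
  have -> : schur_inv n f g = w 0 0.
    rewrite /schur_inv -[w](mulmxK uS1) wS -rowE mxE //.
  by rewrite [RHS]mxE; congr (fun_of_matrix _ _ _); apply/val_inj.
have G0 : G 0 0 = c^*.
  apply: (mulIf g0); rewrite -mul_toep0 -/P GP mxE mul_revmx.
  have -> : rev_ord (0 : 'I_n.+2) = ord_max by apply/val_inj; rewrite /= subn1.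
  by rewrite mxE mulrC.
have WE : W 0 0 = a + t * c^* by rewrite -y0 -G0 mxE [X in _ + X]mxE.
rewrite -/a -W0 WE.
have -> : c = b * (g`_0)^* / (f`_0)^* by rewrite PN mulfK // conjC_eq0.
rewrite !normCK /t rmorphM rmorphM fmorphV /= !conjCK.
by rewrite /last_coef -/y -/P -/b; field; rewrite conjC_eq0 f0 a0 g0.
Qed.

(** The matrix L_n of sign e. *)
Definition toep_block e n : 'M[K]_(n + n) :=
  block_mx (ctr (toep n g)) (e *: ctr (toep n f)) (e *: toep n f) (toep n g).

Lemma unit_ctr n (A : 'M[K]_n) : A \in unitmx -> ctr A \in unitmx.
Proof. by rewrite /ctr unitmx_tr !unitmxE det_map_mx /= !unitfE conjC_eq0. Qed.

Lemma ctr_toep_comm n h h' :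
  ctr (toep n h) *m ctr (toep n h') = ctr (toep n h') *m ctr (toep n h).
Proof. by rewrite -!ctrM toep_comm. Qed.

(** Eliminate the upper right block; the Schur complement times P^* is the Schur
    matrix because P^* and N^* commute. *)
Lemma det_toep_block e n : e * e = 1 ->
  \det (toep_block e n) = \det (schur_mx n f g).
Proof.
move=> ee; set P := toep n g; set N := toep n f.
have uP : ctr P \in unitmx by apply/unit_ctr/unit_toep.
pose Q := invmx (ctr P) *m ctr N.
have PQ : ctr P *m Q = ctr N by rewrite mulmxA mulmxV // mul1mx.
have QP : Q *m ctr P = ctr N by rewrite /Q -mulmxA ctr_toep_comm mulmxA mulVmx
  ?mul1mx.
have e1 : toep_block e n *m block_mx 1%:M (- e *: Q) 0 1%:M =
    block_mx (ctr P) 0 (e *: N) (P - N *m Q).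
  rewrite /toep_block mulmx_block !mulmx1 !mulmx0 !addr0.
  rewrite -!scalemxAr -!scalemxAl PQ -/P -/N scaleNr addNr.
  by rewrite scalerA mulNr ee scaleN1r addrC.
have := congr1 determinant e1; rewrite det_mulmx det_ublock !det1 !mulr1 => ->.
by rewrite det_lblock mulrC -det_mulmx mulmxBl -mulmxA QP.
Qed.

Definition rhs_up n : 'cV[K]_n.+1 := (2 * (f`_0)^*) *: delta_mx ord_max 0.
Definition rhs_dn n : 'cV[K]_n.+1 := (2 * f`_0) *: delta_mx 0 0.

(** Changing the sign of the lower half turns the system of sign - into the one
    of sign + with another right-hand side. Adding both systems leaves only the
    lower right-hand side, and then the vector is (- N^* x, P^* x) with x a
    multiple of the conjugate of the first row of the inverse. *)
Lemma toep_block_sum n (zp zp' zm zm' : 'cV[K]_n.+1) :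
    schur_mx n.+1 f g \in unitmx ->
    toep_block 1 n.+1 *m col_mx zp zp' = - col_mx (rhs_up n) (rhs_dn n) ->
    toep_block (-1) n.+1 *m col_mx zm zm' = col_mx (rhs_up n) (rhs_dn n) ->
  (zp + zm) 0 0 = 4 * `|f`_0| ^+ 2 * schur_inv n f g /\
  (zp' - zm') ord_max 0 = - (4 * f`_0) * (last_coef n)^*.
Proof.
move=> uS; set P := toep n.+1 g; set N := toep n.+1 f.
have uP : ctr P \in unitmx by apply/unit_ctr/unit_toep.
rewrite opp_col_mx !mul_block_col !scale1r !scaleN1r !mulNmx.
move=> /eq_col_mx[ep1 ep2] /eq_col_mx[em1 em2].
set u := zp + zm; set v := zp' - zm'.
have e1 : ctr P *m u + ctr N *m v = 0.
  by rewrite /u /v mulmxDr mulmxBr addrACA ep1 em1 addNr.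
have e2 : N *m u + P *m v = - 2%:R *: rhs_dn n.
  rewrite /u /v mulmxDr mulmxBr.
  have -> : N *m zp + N *m zm + (P *m zp' - P *m zm') =
     (N *m zp + P *m zp') - (- (N *m zm) + P *m zm').
    by rewrite opprD opprK addrACA.
  by rewrite ep2 em2 -opprD -mulr2n -scaler_nat scaleNr.
pose x := invmx (ctr P) *m v.
have vE : v = ctr P *m x by rewrite mulmxA mulmxV // mul1mx.
have uE : u = - (ctr N *m x).
  apply: (can_inj (mulKmx uP)); rewrite mulmxN mulmxA ctr_toep_comm -mulmxA.
  by rewrite -vE; apply/eqP; rewrite -addr_eq0 e1.
have xE : x = - (4 * f`_0) *: ctr (first_row n).
  apply: (can_inj (mulKmx uS)); rewrite -scalemxAr -[in RHS]ctr_schur_mx -ctrM.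
  rewrite first_rowE // ctr_delta mulmxBl -!mulmxA -vE -mulmxN -uE.
  rewrite addrC e2 scalerA; congr (_ *: _); ring.
have v0 : v ord_max 0 = - (4 * f`_0) * (last_coef n)^*.
  by rewrite vE xE -scalemxAr -ctrM mxE ctrE.
split=> //.
rewrite uE xE -scalemxAr -ctrM scaleNr opprK mxE ctrE mul_toep0 rmorphM /=.
by rewrite [first_row n _ _]mxE -/(schur_inv n f g) schur_inv_conj // normCK;
  ring.
Qed.

(** This is [levinson] at the start of the recursion, with - 1 / |f_0|^2 in
    place of the previous alpha. *)
Lemma last_coef0 : schur_mx 1 f g \in unitmx ->
  `|last_coef 0| ^+ 2 =
    `|f`_0| ^+ 2 * schur_inv 0 f g ^+ 2 + schur_inv 0 f g.
Proof.
move=> uS; set a := schur_inv 0 f g.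
have ra : a^* = a by apply: schur_inv_conj.
have e0 : schur_mx 1 f g 0 0 = `|g`_0| ^+ 2 - `|f`_0| ^+ 2.
  by rewrite !mxE !big_ord1 !ctrE !mxE /= !normCK.
have ae : a * (`|g`_0| ^+ 2 - `|f`_0| ^+ 2) = 1.
  have := mulVmx uS => /matrixP/(_ 0 0); rewrite [X in X = _]mxE big_ord1 e0.
  by rewrite -/(schur_inv 0 f g) -/a => ->; rewrite mxE.
have -> : last_coef 0 = a * g`_0.
  rewrite /last_coef (_ : ord_max = 0) ?mul_toep0; last exact/val_inj.
  by rewrite [first_row 0 _ _]mxE.
rewrite normrM exprMn [`|a| ^+ 2]normCK ra.
transitivity (`|f`_0| ^+ 2 * a ^+ 2 +
    a * (a * (`|g`_0| ^+ 2 - `|f`_0| ^+ 2))); first by ring.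
by rewrite ae mulr1.
Qed.

(** Twice the determinant of Z, written with the sum and the difference of the
    two solutions. *)
Lemma cross_term n (zp zp' zm zm' : 'cV[K]_n.+1) :
    schur_mx n.+1 f g \in unitmx ->
    toep_block 1 n.+1 *m col_mx zp zp' = - col_mx (rhs_up n) (rhs_dn n) ->
    toep_block (-1) n.+1 *m col_mx zm zm' = col_mx (rhs_up n) (rhs_dn n) ->
    zp' ord_max 0 = (zp 0 0)^* -> zm' ord_max 0 = (zm 0 0)^* ->
  zp 0 0 * (zm 0 0)^* + (zp 0 0)^* * zm 0 0 =
  8 * `|f`_0| ^+ 2 *
    (`|f`_0| ^+ 2 * schur_inv n f g ^+ 2 - `|last_coef n| ^+ 2).
Proof.
move=> uS ep em ezp ezm; have [] := toep_block_sum uS ep em.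
rewrite [X in X = _ -> _]mxE [X in _ -> X = _ -> _]mxE.
rewrite [X in _ -> _ + X = _ -> _]mxE ezp ezm.
set p := zp 0 0; set m := zm 0 0; set a := schur_inv n f g => eu ev.
have ra : a^* = a by apply: schur_inv_conj.
have ev' : p - m = - (4 * (f`_0)^*) * last_coef n.
  rewrite -[LHS]conjCK rmorphB /= ev rmorphM rmorphN rmorphM /= !conjCK.
  by rewrite rmorph_nat.
have eu' : p^* + m^* = 4 * `|f`_0| ^+ 2 * a.
  by rewrite -rmorphD /= eu !rmorphM /= ra rmorph_nat conj_normC.
(* Polarization. *)
have -> : p * m^* + p^* * m =
    ((p + m) * (p^* + m^*) - (p - m) * (p^* - m^*)) / 2 by field.
by rewrite eu eu' ev ev' !normCK; field.
Qed.

Definition conj_pair n (z : 'cV[K]_n) : 'cV[K]_(n + n) :=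
  col_mx z (revmx n *m map_mx Num.conj z).

Lemma conj_pairD n (z z' : 'cV[K]_n) :
  conj_pair (z + z') = conj_pair z + conj_pair z'.
Proof. by rewrite /conj_pair map_mxD mulmxDr add_col_mx. Qed.

Lemma conj_pair_inj n : injective (@conj_pair n).
Proof. by move=> z z' /eq_col_mx[]. Qed.

(** The conjugate linear involution whose fixed points are the vectors of the
    form [conj_pair z]. *)
Definition conj_flip n (w : 'cV[K]_(n + n)) : 'cV[K]_(n + n) :=
  col_mx (revmx n *m map_mx Num.conj (dsubmx w))
         (revmx n *m map_mx Num.conj (usubmx w)).

Lemma revmxK m n (A : 'M[K]_(n, m)) : revmx n *m (revmx n *m A) = A.
Proof. by apply/matrixP => i j; rewrite !revmx_mul rev_ordK. Qed.

Lemma map_conjK m n (A : 'M[K]_(n, m)) :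
  map_mx Num.conj (map_mx Num.conj A) = A.
Proof. by apply/matrixP => i j; rewrite !mxE conjCK. Qed.

Lemma map_conj_rev m n (A : 'M[K]_(n, m)) :
  map_mx Num.conj (revmx n *m A) = revmx n *m map_mx Num.conj A.
Proof. by apply/matrixP => i j; rewrite mxE !revmx_mul mxE. Qed.

Lemma conj_flip_fixed n (w : 'cV[K]_(n + n)) :
  conj_flip w = w -> w = conj_pair (usubmx w).
Proof.
move=> e; rewrite -[LHS]vsubmxK /conj_pair -{2}e /conj_flip.
by congr col_mx; rewrite -{1}e /conj_flip col_mxKd.
Qed.

Lemma conj_flip_pair n (z : 'cV[K]_n) : conj_flip (conj_pair z) = conj_pair z.
Proof.
by rewrite /conj_flip /conj_pair col_mxKu col_mxKd map_conj_rev revmxK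
  map_conjK.
Qed.

Lemma conj_flipK n (w : 'cV[K]_(n + n)) : conj_flip (conj_flip w) = w.
Proof.
rewrite /conj_flip col_mxKu col_mxKd !map_conj_rev !revmxK !map_conjK.
by rewrite vsubmxK.
Qed.

Lemma conj_flipD n (w w' : 'cV[K]_(n + n)) :
  conj_flip (w + w') = conj_flip w + conj_flip w'.
Proof. by rewrite /conj_flip !linearD /= !map_mxD !mulmxDr add_col_mx. Qed.

Lemma conj_flipZ n c (w : 'cV[K]_(n + n)) :
  conj_flip (c *: w) = c^* *: conj_flip w.
Proof. by rewrite /conj_flip !linearZ /= !map_mxZ -!scalemxAr scale_col_mx. Qed.

Lemma conj_flipN n (w : 'cV[K]_(n + n)) : conj_flip (- w) = - conj_flip w.
Proof. by rewrite -[in LHS]scaleN1r conj_flipZ rmorphN1 scaleN1r. Qed.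

Lemma toep_block_flip e n (w : 'cV[K]_(n + n)) : e^* = e ->
  toep_block e n *m conj_flip w = conj_flip (toep_block e n *m w).
Proof.
move=> re; rewrite -{2}[w]vsubmxK /toep_block /conj_flip !mul_block_col.
rewrite col_mxKu col_mxKd; set u := usubmx w; set v := dsubmx w.
have up h x : ctr (toep n h) *m (revmx n *m map_mx Num.conj x) =
    revmx n *m map_mx Num.conj (toep n h *m x) :> 'cV_n.
  rewrite map_mxM 2!mulmxA; congr (_ *m _); apply/matrixP => i k.
  by rewrite mul_revmx revmx_mul ctrE [RHS]mxE toep_persym.
have dn h x : toep n h *m (revmx n *m map_mx Num.conj x) =
    revmx n *m map_mx Num.conj (ctr (toep n h) *m x) :> 'cV_n.
  rewrite map_mxM 2!mulmxA; congr (_ *m _); apply/matrixP => i k.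
  rewrite mul_revmx revmx_mul [RHS]mxE ctrE /= conjCK.
  by rewrite -{1}[ i ]rev_ordK toep_persym rev_ordK.
rewrite !map_mxD !mulmxDr -!scalemxAl !map_mxZ /= re !up !dn -!scalemxAr.
by rewrite addrC; congr col_mx; rewrite addrC.
Qed.

(** Only vectors fixed by [conj_flip] count as solutions, but the system
    commutes with this involution: if w is in the kernel so are the fixed
    vectors w + conj_flip w and i (w - conj_flip w), which do not both vanish
    unless w does. *)
Lemma toep_block_unique e n (z0 : 'cV[K]_n) : e^* = e ->
  (exists! z, toep_block e n *m conj_pair z = conj_pair z0) <->
  toep_block e n \in unitmx.
Proof.
move=> re; split=> [[z [ez uz]]|uL].
  rewrite unitmxE unitfE -det_tr; apply/negP => /det0P[w0 nz].
  move/(congr1 trmx); rewrite trmx_mul trmxK trmx0; set w := w0^T => ew.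
  have nw : w != 0 by rewrite trmx_eq0.
  have fixed0 x : toep_block e n *m x = 0 -> conj_flip x = x -> x = 0.
    move=> ex /conj_flip_fixed xE; have := uz (z + usubmx x).
    rewrite conj_pairD mulmxDr -xE ex addr0 ez => /(_ erefl).
    move/(congr1 (+%R (- z))); rewrite addNr addKr => x0.
    by rewrite xE -x0 /conj_pair map_mx0 mulmx0 col_mx0.
  have ew' : toep_block e n *m conj_flip w = 0.
    by rewrite toep_block_flip // ew /conj_flip !linear0 /= !map_mx0 !mulmx0
      col_mx0.
  have h1 : w + conj_flip w = 0.
    apply: fixed0; first by rewrite mulmxDr ew ew' addr0.
    by rewrite conj_flipD conj_flipK addrC.
  have h2 : 'i *: (w - conj_flip w) = 0.
    apply: fixed0; first by rewrite -scalemxAr mulmxBr ew ew' subr0 scaler0.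
    rewrite conj_flipZ conjCi conj_flipD conj_flipN conj_flipK.
    by rewrite scaleNr -scalerN opprB.
  case/negP: nw; apply/eqP; move/eqP: h2.
  rewrite scaler_eq0 (negPf (neq0Ci K)) /= subr_eq0 => /eqP h2.
  move: h1; rewrite -h2 -mulr2n -scaler_nat => /eqP.
  by rewrite scaler_eq0 pnatr_eq0 => /eqP.
pose w := invmx (toep_block e n) *m conj_pair z0.
have ew : toep_block e n *m w = conj_pair z0 by rewrite mulmxA mulmxV // mul1mx.
have wE : w = conj_pair (usubmx w).
  apply: conj_flip_fixed; apply: (can_inj (mulKmx uL)).
  by rewrite toep_block_flip // ew conj_flip_pair.
exists (usubmx w); split; first by rewrite -wE.
move=> z' ez'; apply: conj_pair_inj; rewrite -wE.
by apply: (can_inj (mulKmx uL)); rewrite ez' ew.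
Qed.

End Levinson.

(** * The matrices of an exponential polynomial *)

Section Bridge.
Variables (R : realType) (d : nat) (C : d.+1.-tuple R[i]).
Hypothesis C_ends : C`_0 * C`_d != 0.

Local Notation f := (fpoly C).

(** The polynomial f* of the introduction, of formal degree d. *)
Definition fpoly_recip : {poly R[i]} := \poly_(k < d.+1) (C`_(d - k))^*.
Local Notation g := fpoly_recip.

Lemma coef_fpoly k : f`_k = C`_k.
Proof.
have -> : f = \poly_(k < d.+1) C`_k.
  rewrite /fpoly poly_def [RHS](reindex_inj rev_ord_inj) /=.
  by apply: eq_bigr => i _; rewrite subSS.
rewrite coef_poly; case: ltnP => // le_d.
by rewrite nth_default // size_tuple.
Qed.

Lemma fpoly0_neq0 : f`_0 != 0.
Proof. by rewrite coef_fpoly; move: C_ends; rewrite mulf_eq0 => /norP[]. Qed.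

Lemma fpolyd_neq0 : C`_d != 0.
Proof. by move: C_ends; rewrite mulf_eq0 => /norP[]. Qed.

Lemma recip0_neq0 : g`_0 != 0.
Proof. by rewrite coef_poly /= subn0 conjC_eq0 fpolyd_neq0. Qed.

Lemma size_fpoly : size f = d.+1.
Proof.
apply/anti_leq/andP; split.
  by apply/leq_sizeP => k le_k; rewrite coef_fpoly nth_default // size_tuple.
by rewrite ltnNge; apply/negP => /leq_sizeP/(_ d (leqnn d))/eqP;
  rewrite coef_fpoly (negPf fpolyd_neq0).
Qed.

Lemma fpoly_split : exists s : seq R[i],
  [/\ size s = d, f = C`_d *: monic_of s & g = (C`_d)^* *: recip_of s].
Proof.
have [s fE] := closed_field_poly_normal f.
have lead : lead_coef f = C`_d by rewrite lead_coefE size_fpoly coef_fpoly.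
rewrite lead in fE.
have sz : size s = d.
  by move: size_fpoly; rewrite fE size_scale ?fpolyd_neq0 // size_prod_XsubC
    => -[].
exists s; split=> //; apply/polyP => k; rewrite coef_poly coefZ.
case: ltnP => [|le_k]; last first.
  by rewrite [X in _ * X]nth_default ?mulr0 // (leq_trans (size_recip_of s))
    // sz.
rewrite ltnS => le_k; rewrite recip_of_coef sz // -rmorphM /=; congr (_ ^*).
by rewrite -coef_fpoly fE coefZ.
Qed.

Lemma root_fpoly s w : f = C`_d *: monic_of s -> root f w = (w \in s).
Proof. by move=> ->; rewrite rootZ ?fpolyd_neq0 // root_prod_XsubC. Qed.

Lemma toepN_E n : toepN C n = toep n f.
Proof. by apply/matrixP => j k; rewrite !mxE coef_fpoly. Qed.

Lemma toepM_E n : (n <= d)%N -> (toepM C n)^T = ctr (toep n g).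
Proof.
move=> le_n; apply/matrixP => k j; rewrite ctrE !mxE.
case: ifP => _; last by rewrite rmorph0.
rewrite coef_poly ltnS (leq_trans (leq_subr _ _)) ?conjCK //.
by rewrite (leq_trans _ le_n) // ltnW.
Qed.

Lemma Lmx_E e n : (n <= d)%N -> Lmx C e n = toep_block f g e n.
Proof.
move=> le_n; rewrite /Lmx /toep_block toepN_E -toepM_E //; congr block_mx.
by apply: trmx_inj; rewrite map_trmx toepM_E // /ctr -map_trmx map_conjK.
Qed.

Lemma Ddet_E n : (n <= d)%N -> Ddet C n = \det (schur_mx n f g).
Proof.
by move=> le_n; rewrite /Ddet Lmx_E // det_toep_block ?mulr1 ?recip0_neq0.
Qed.

Lemma conj_ext_E n (z : 'cV[R[i]]_n) : conj_ext z = conj_pair z.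
Proof.
by congr col_mx; apply/matrixP => k j; rewrite revmx_mul !mxE ord1.
Qed.

Lemma rhs_E n : rhs C n.+1 = col_mx (rhs_up f n) (rhs_dn f n).
Proof.
congr col_mx; apply/matrixP => k j; rewrite !mxE !coef_fpoly ord1 eqxx andbT.
  rewrite eqSS -[_ == n]/(_ == ord_max :> 'I_n.+1).
  by case: eqP => _; rewrite ?mulr1 ?mulr0.
by rewrite -[nat_of_ord k == 0%N]/(k == 0); case: eqP => _;
  rewrite ?mulr1 ?mulr0.
Qed.

Lemma rhs_pair n : rhs C n.+1 = conj_pair (rhs_up f n).
Proof.
rewrite rhs_E; congr col_mx; apply/matrixP => k j; rewrite revmx_mul !mxE ord1.
rewrite eqxx andbT.
have -> : (rev_ord k == ord_max) = (k == 0).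
  rewrite (can2_eq rev_ordK rev_ordK); congr (_ == _).
  by apply/val_inj; rewrite /= subnn.
by rewrite !rmorphM /= conjCK !rmorph_nat andbT.
Qed.

Lemma zsol_unique e n : (n < d)%N -> e^* = e -> e * e = 1 ->
  (exists! z : 'cV[R[i]]_n.+1, is_zsol C e z) <->
  schur_mx n.+1 f g \in unitmx.
Proof.
move=> lt_n re ee; rewrite unitmxE -(det_toep_block _ recip0_neq0 _ ee)
  -unitmxE.
rewrite -(toep_block_unique _ _ (- e *: rhs_up f n) re).
have solE z : is_zsol C e z <->
    toep_block f g e n.+1 *m conj_pair z = conj_pair (- e *: rhs_up f n).
  rewrite /is_zsol Lmx_E // conj_ext_E rhs_pair.
  suff -> : conj_pair (- e *: rhs_up f n) = - e *: conj_pair (rhs_up f n) by [].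
  by rewrite /conj_pair scale_col_mx map_mxZ rmorphN /= re -scalemxAr.
by split=> -[z [/solE ez uz]]; exists z; split=> // z' /solE; apply: uz.
Qed.

(** Positivity of the D_n is positive definiteness of the Schur matrix of size d
    by [sylvester], and [schur_criterion] applies to the roots of f. *)
Lemma Ddet_roots :
  (forall n, (1 <= n <= d)%N -> 0 < Ddet C n) <->
  (forall w, root f w -> `|w| < 1).
Proof.
have [s [sz fE gE]] := fpoly_split.
have syl := sylvester (fun n => ctr_schur_mx n f g)
  (fun n => schur_mx_nested n f g) d.
have crit := schur_criterion s fpolyd_neq0.
rewrite -fE -gE sz in crit.
split=> [pos w|roots n /andP[n0 le_n]].
  rewrite (root_fpoly w fE); apply: (crit.1 (syl.1 _)) => n /andP[n0 le_n].
  by rewrite -Ddet_E // pos // n0.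
rewrite Ddet_E //; apply: (syl.2 _ n); last by rewrite n0.
by apply: crit.2 => a a_s; apply: roots; rewrite (root_fpoly _ fE).
Qed.

End Bridge.

(** * Two by two matrices intertwining the symplectic unit *)

Section TwoByTwo.
Variable R : realType.
Implicit Types P H : 'M[R]_2.

Lemma big_ord2 (F : 'I_2 -> R) : \sum_i F i = F 0 + F 1.
Proof.
rewrite !big_ord_recl big_ord0 addr0; congr (_ + F _); exact: val_inj.
Qed.

Lemma det_mx22 P : \det P = P 0 0 * P 1 1 - P 0 1 * P 1 0.
Proof.
rewrite (expand_det_row _ 0) big_ord2 /cofactor !det_mx11 !mxE.
have e0 : lift 1 0 = 0 :> 'I_2 by apply: val_inj.
have e1 : lift 0 0 = 1 :> 'I_2 by apply: val_inj.
rewrite e0 e1 /=.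
by rewrite expr0 expr1 mul1r mulN1r mulrN.
Qed.

Lemma det_mx2 (a b c e : R) : \det (mx2 a b c e) = a * e - b * c.
Proof. by rewrite det_mx22 !mxE. Qed.

Local Notation J := (mx2 0 (-1) 1 0 : 'M[R]_2).
Local Notation J' := (mx2 0 1 (-1) 0 : 'M[R]_2).

Lemma ord2P (Q : 'I_2 -> Prop) : Q 0 -> Q 1 -> forall i, Q i.
Proof.
by move=> Q0 Q1 [[|[|//]] lt_i]; [move: Q0|move: Q1]; congr Q; apply: val_inj.
Qed.

(** For matrices of size two, being symplectic amounts to determinant one. *)
Lemma symplectic P : P *m J *m P^T = \det P *: J.
Proof.
apply/matrixP; apply: ord2P; apply: ord2P; rewrite det_mx22;
rewrite mxE big_ord2 ![(P *m J) _ _]mxE !big_ord2 !mxE /=; ring.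
Qed.

Definition intertwiner P : 'M[R]_2 := - (\det P)^-1 *: (P^T *m P).

Definition intertwines P H := H^T = H /\ P *m J *m H = J' *m P.

Lemma intertwinerP P : \det P != 0 -> intertwines P (intertwiner P).
Proof.
move=> P0; split.
  by rewrite /intertwiner linearZ /= trmx_mul trmxK.
rewrite /intertwiner -scalemxAr mulmxA symplectic -scalemxAl scalerA mulNr
  mulVf //.
rewrite scaleN1r -mulNmx; congr (_ *m _).
by apply/matrixP; apply: ord2P; apply: ord2P; rewrite !mxE /= ?oppr0 ?opprK.
Qed.

(** A singular P leaves room for v^T v, where v^T spans the kernel of P J. *)
Lemma intertwines_unique P : (exists! H, intertwines P H) <-> \det P != 0.
Proof.
split=> [[H [[sH eH] uH]]|P0].
  have uJ : J \in unitmx.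
    by rewrite unitmxE det_mx2 unitfE mul0r sub0r mulN1r opprK oner_neq0.
  apply/negP => P0.
  have /det0P[v v0] : \det (P *m J)^T == 0 by rewrite det_tr det_mulmx
    (eqP P0) mul0r.
  move/(congr1 trmx); rewrite trmx_mul trmxK trmx0 => ev.
  have : intertwines P (H + v^T *m v).
    split; first by rewrite linearD /= sH trmx_mul trmxK.
    by rewrite mulmxDr mulmxA ev mul0mx addr0 eH.
  move/uH/(congr1 (+%R (- H))); rewrite addNr addKr => vv0.
  case/negP: v0; apply/eqP/rowP => k; rewrite mxE; apply/eqP.
  have := congr1 (fun A : 'M[R]_2 => A k k) vv0.
  by rewrite !mxE big_ord1 !mxE => /esym/eqP; rewrite mulf_eq0 orbb.
exists (intertwiner P); split; first exact: intertwinerP.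
move=> H [sH eH]; have [_ eH'] := intertwinerP P0.
have uPJ : P *m J \in unitmx.
  by rewrite unitmxE det_mulmx det_mx2 mul0r sub0r mulN1r opprK mulr1 unitfE.
by apply: (can_inj (mulKmx uPJ)); rewrite eH eH'.
Qed.

Lemma posdef_intertwiner P : \det P != 0 ->
  posdefmx (intertwiner P) <-> \det P < 0.
Proof.
move=> P0.
have qE v : quad_form (intertwiner P) v =
    - (\det P)^-1 * ((P *m v) 0 0 ^+ 2 + (P *m v) 1 0 ^+ 2).
  rewrite /quad_form /intertwiner -scalemxAr -scalemxAl mxE; congr (_ * _).
  have -> : v^T *m (P^T *m P) *m v = (P *m v)^T *m (P *m v).
    by rewrite trmx_mul !mulmxA.
  by rewrite mxE big_ord2 ![_^T _ _]mxE !expr2.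
have sq (v : 'cV[R]_2) : v != 0 -> 0 < (P *m v) 0 0 ^+ 2 + (P *m v) 1 0 ^+ 2.
  move=> v0; rewrite lt_def addr_ge0 ?sqr_ge0 // andbT.
  rewrite paddr_eq0 ?sqr_ge0 // !sqrf_eq0;
    apply: contra v0 => /andP[/eqP e0 /eqP e1].
  have Pv : P *m v = 0.
    by apply/colP; apply: ord2P; rewrite ?e0 ?e1 mxE.
  have uP : P \in unitmx by rewrite unitmxE unitfE.
  by rewrite -(mulKmx uP v) Pv mulmx0.
split=> [[_ pos]|neg]; last first.
  split; first by case: (intertwinerP P0).
  by move=> v v0; rewrite qE mulr_gt0 ?sq // oppr_gt0 invr_lt0.
have e0 : (delta_mx 0 0 : 'cV[R]_2) != 0.
  by apply/negP => /eqP/colP/(_ 0)/eqP; rewrite !mxE !eqxx oner_eq0.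
by have := pos _ e0; rewrite qE pmulr_lgt0 ?sq // oppr_gt0 invr_lt0.
Qed.

End TwoByTwo.

(** * The Hamiltonian *)

Section Hamiltonian.
Variables (R : realType) (d : nat) (C : d.+1.-tuple R[i]).
Hypothesis C_ends : C`_0 * C`_d != 0.
Local Notation f := (fpoly C).
Local Notation g := (fpoly_recip C).
Local Notation S n := (schur_mx n f g).

Lemma Re_mul_conj (x y : R[i]) :
  (complex.Re x * complex.Re y + complex.Im x * complex.Im y)%:C%C =
  (x * y^* + x^* * y) / 2.
Proof.
apply: (mulIf (_ : 2 != 0 :> R[i])); first by rewrite pnatr_eq0.
rewrite divfK ?pnatr_eq0 //; case: x y => [a b] [a' b'].
by apply/eqP; rewrite eq_complex /=; apply/andP; split; apply/eqP; ring.
Qed.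

Lemma zsolP e n : (n < d)%N -> e^* = e -> e * e = 1 -> S n.+1 \in unitmx ->
  toep_block f g e n.+1 *m conj_pair (zsol C e n.+1) =
    - e *: col_mx (rhs_up f n) (rhs_dn f n).
Proof.
move=> lt_n re ee uS.
have [z [ez _]] := (zsol_unique C_ends lt_n re ee).2 uS.
have : is_zsol C e (zsol C e n.+1).
  by rewrite /zsol; apply: (xgetPex 0 (P := [set z | is_zsol C e z])); exists z.
by rewrite /is_zsol (Lmx_E _ _ lt_n) conj_ext_E rhs_E => e0; exact: e0.
Qed.

Lemma det_Zmx_cross n : (n < d)%N -> S n.+1 \in unitmx ->
  (\det (Zmx C n.+1))%:C%C =
  4 * `|f`_0| ^+ 2 *
    (`|f`_0| ^+ 2 * schur_inv n f g ^+ 2 - `|last_coef f g n| ^+ 2).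
Proof.
move=> lt_n uS; rewrite /Zmx det_mx2.
have ep := zsolP lt_n (rmorph1 _) (mulr1 1) uS.
have N1s : (-1 : R[i]) * -1 = 1 by rewrite mulrNN mulr1.
have em := zsolP lt_n (rmorphN1 _) N1s uS.
rewrite scaleN1r in ep; rewrite opprK scale1r in em.
set zp := zsol C 1 n.+1 in ep *; set zm := zsol C (-1) n.+1 in em *.
have lastE (z : 'cV[R[i]]_n.+1) :
    (revmx R[i] n.+1 *m map_mx Num.conj z) ord_max 0 = (z 0 0)^* :> R[i].
  rewrite revmx_mul mxE; congr (Num.conj (fun_of_matrix z _ _)).
  by apply/val_inj; rewrite /= subnn.
have := cross_term (recip0_neq0 C_ends) uS ep em (lastE zp) (lastE zm).
move=> /(congr1 (fun x => x / 2)) e.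
transitivity ((zp 0 0 * (zm 0 0)^* + (zp 0 0)^* * zm 0 0) / 2); last first.
  by rewrite e; field.
by rewrite -Re_mul_conj; congr (_ %:C)%C; rewrite mulrN opprK.
Qed.

Lemma det_Zmx1 : (0 < d)%N -> S 1 \in unitmx ->
  (\det (Zmx C 1))%:C%C = - (4 * `|f`_0| ^+ 2 * schur_inv 0 f g).
Proof. by move=> d0 uS; rewrite det_Zmx_cross // last_coef0 //; ring. Qed.

Lemma det_ZmxSS n : (n.+1 < d)%N -> S n.+1 \in unitmx -> S n.+2 \in unitmx ->
  (\det (Zmx C n.+2))%:C%C =
    4 * `|f`_0| ^+ 4 * (schur_inv n.+1 f g * schur_inv n f g).
Proof.
move=> lt_n uS1 uS; rewrite det_Zmx_cross // levinson //; first by ring.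
- exact: fpoly0_neq0.
- exact: recip0_neq0.
Qed.

(** In the product each factor alpha_n alpha_(n-1) meets the alpha_(n-1) left by
    the previous ones, which is thereby squared. *)
Lemma det_Zprod n : (n < d)%N -> (forall k, (k <= n)%N -> S k.+1 \in unitmx) ->
  exists2 c : R[i], 0 < c &
    (\det (Zprod C n.+1))%:C%C = - (c * schur_inv n f g).
Proof.
elim: n => [|n IHn] lt_n uS.
  exists (4 * `|f`_0| ^+ 2).
    by rewrite mulr_gt0 ?ltr0n // exprn_gt0 // normr_gt0 fpoly0_neq0.
  by rewrite /= mulmx1 -det_Zmx1 ?uS.
have [k le_k|c c0 eP] := IHn (ltnW lt_n); first by apply/uS/leqW.
exists (4 * `|f`_0| ^+ 4 * c * `|schur_inv n f g| ^+ 2).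
  have a0 : schur_inv n f g != 0.
    rewrite (schur_invE (uS n (leqnSn n))) mulf_neq0 ?invr_eq0 //; last first.
      by rewrite -unitfE -unitmxE uS.
    case: n {IHn lt_n eP} uS => [|n] uS; first by rewrite det_mx00 oner_eq0.
    by rewrite -unitfE -unitmxE uS // ltnW.
  by rewrite !mulr_gt0 ?ltr0n ?exprn_gt0 ?normr_gt0 ?(fpoly0_neq0 C_ends).
have -> : Zprod C n.+2 = Zmx C n.+2 *m Zprod C n.+1 by [].
have realM (x y : R) : (x * y)%:C%C = x%:C%C * y%:C%C by rewrite rmorphM.
rewrite det_mulmx realM eP det_ZmxSS ?uS //.
rewrite normCK schur_inv_conj ?uS //; ring.
Qed.

Lemma schur_det_pos : (forall n, (0 < n <= d)%N -> 0 < \det (S n)) <->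
  (forall n, (n < d)%N -> S n.+1 \in unitmx /\ 0 < schur_inv n f g).
Proof.
split=> [pos n lt_n|pos].
  have pS : 0 < \det (S n.+1) by rewrite pos.
  have uS : S n.+1 \in unitmx by rewrite unitmxE unitfE gt_eqF.
  split=> //; rewrite schur_invE // divr_gt0 //.
  case: n lt_n {pS uS} => [|n] lt_n; first by rewrite det_mx00.
  by rewrite pos //= ltnW.
have pos' n : (n <= d)%N -> 0 < \det (S n).
  elim: n => [|n IHn] lt_n; first by rewrite det_mx00.
  have [uS] := pos n lt_n; rewrite schur_invE // pmulr_rgt0 ?IHn 1?ltnW //.
  by rewrite invr_gt0.
by move=> n /andP[_]; apply: pos'.
Qed.

Lemma Ddet_Zprod :
  (forall n, (1 <= n <= d)%N -> 0 < Ddet C n) <->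
  (forall n, (n < d)%N -> S n.+1 \in unitmx /\ \det (Zprod C n.+1) < 0).
Proof.
have Zneg n : (n < d)%N -> (forall k, (k <= n)%N -> S k.+1 \in unitmx) ->
    (\det (Zprod C n.+1) < 0) = (0 < schur_inv n f g).
  move=> lt_n uS; have [c c0 e] := det_Zprod lt_n uS.
  by rewrite -ltcR e oppr_lt0 pmulr_rgt0.
have DE n : (1 <= n <= d)%N -> (0 < Ddet C n) = (0 < \det (S n)).
  by case/andP=> _ le_n; rewrite (Ddet_E C_ends).
transitivity (forall n, (0 < n <= d)%N -> 0 < \det (S n)).
  by split=> pos n le_n; have := pos n le_n; rewrite DE.
rewrite schur_det_pos; split=> pos n lt_n; have [uS p] := pos n lt_n;
  split=> //.
  by rewrite Zneg // => k le_k; have [] := pos k (leq_ltn_trans le_k lt_n).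
by rewrite -Zneg // => k le_k; have [] := pos k (leq_ltn_trans le_k lt_n).
Qed.

Lemma well_defined_unit : hamiltonian_well_defined C <->
  (forall n, (n < d)%N -> S n.+1 \in unitmx /\ \det (Zprod C n.+1) != 0).
Proof.
have N1c : (-1 : R[i])^* = -1 by rewrite rmorphN1.
have N1s : (-1 : R[i]) * -1 = 1 by rewrite mulrNN mulr1.
split=> [wd n lt_n|wd [//|n] /= lt_n].
  have [//|h1 _ h3] := wd n.+1; split; last exact/(intertwines_unique _).1.
  by apply: (zsol_unique C_ends lt_n (rmorph1 _) (mulr1 1)).1.
have [uS Z0] := wd n lt_n; split; last exact: (intertwines_unique _).2.
  by apply: (zsol_unique C_ends lt_n (rmorph1 _) (mulr1 1)).2.
by apply: (zsol_unique C_ends lt_n N1c N1s).2.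
Qed.

Lemma Hmx_E n : \det (Zprod C n) != 0 -> Hmx C n = intertwiner (Zprod C n).
Proof.
move=> Z0; have [H [eH uH]] := (intertwines_unique (Zprod C n)).2 Z0.
rewrite -(uH _ (intertwinerP Z0)); apply/esym/uH.
by apply: (xgetPex 0 (P := [set H | is_Hmx C n H])); exists H.
Qed.

Local Notation rr := ((freqr d)%:R : R).

Lemma freqr_gt0 : 0 < rr.
Proof. by rewrite ltr0n /freqr; case: odd. Qed.

Lemma freqL_E : (freqL d)%:R = rr * d%:R / 2 :> R.
Proof.
rewrite /freqL /freqr; case: ifP => dO; first by field.
rewrite mul1r -[in RHS](odd_double_half d) dO add0n -mul2n natrM.
by rewrite mulrC mulKf ?pnatr_eq0.
Qed.

(** Steps are numbered from 0, so that step n carries the matrix of index n +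
    1. *)
Definition in_step n (t : R) := (rr * n%:R / 2 <= t) && (t < rr * n.+1%:R / 2).

Lemma in_stepE n t : in_step n t = (n%:R <= t * 2 / rr < n.+1%:R).
Proof.
have r0 := freqr_gt0.
rewrite /in_step ler_pdivlMr // ltr_pdivrMr // ler_pdivrMr ?ltr0n //.
by rewrite ltr_pdivlMr ?ltr0n // ![_ * rr]mulrC.
Qed.

Lemma in_step_exists t : 0 <= t < (freqL d)%:R ->
  exists2 n, (n < d)%N & in_step n t.
Proof.
case/andP=> t0; rewrite freqL_E => tl; have r0 := freqr_gt0.
have x0 : 0 <= t * 2 / rr by rewrite !mulr_ge0 ?invr_ge0 ?ler0n // ltW.
have /andP[le1 lt2] := truncn_itv x0.
exists (Num.truncn (t * 2 / rr)); last by rewrite in_stepE le1.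
rewrite -(ltr_nat R); apply: le_lt_trans le1 _.
by rewrite ltr_pdivrMr // [_ * rr]mulrC -ltr_pdivlMr ?ltr0n.
Qed.

Lemma hamiltonian_step n t : (n < d)%N -> in_step n t ->
  hamiltonian C t = Hmx C n.+1.
Proof.
move=> lt_n tn; rewrite /hamiltonian big_mkcond (bigD1_seq n.+1) ?iota_uniq
  //=; last first.
  by rewrite mem_index_iota ltnS.
rewrite -/(in_step n t) tn big_seq_cond big1 ?addr0 // => m.
case: m => [|m]; first by rewrite mem_index_iota.
rewrite mem_index_iota /= eqSS -/(in_step m t) => /andP[_ ne];
  case: ifP => // tm.
case/eqP: ne; move: tm tn; rewrite !in_stepE => /andP[m1 m2] /andP[n1 n2].
have lt1 := le_lt_trans m1 n2; have lt2 := le_lt_trans n1 m2.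
by apply/eqP; rewrite eqn_leq -ltnS -(ltr_nat R) lt1 -ltnS -(ltr_nat R) lt2.
Qed.

Lemma step_start n : (n < d)%N ->
  exists2 t, 0 <= t < (freqL d)%:R & in_step n t.
Proof.
move=> lt_n; have r0 := freqr_gt0; exists (rr * n%:R / 2).
  rewrite freqL_E ltr_pM2r ?invr_gt0 // ltr_pM2l // ltr_nat lt_n andbT.
  by rewrite !mulr_ge0 ?invr_ge0 ?ler0n // ltW.
by rewrite /in_step lexx ltr_pM2r ?invr_gt0 // ltr_pM2l // ltr_nat /=.
Qed.

Lemma Ddet_hamiltonian :
  (forall n, (1 <= n <= d)%N -> 0 < Ddet C n) <->
  hamiltonian_well_defined C /\
  (forall t : R, 0 <= t < (freqL d)%:R -> posdefmx (hamiltonian C t)).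
Proof.
rewrite Ddet_Zprod; split=> [pos|[/well_defined_unit wd pos] n lt_n].
  split=> [|t /in_step_exists[n lt_n tn]].
    by apply/well_defined_unit => n /pos[uS Z0]; rewrite lt_eqF.
  have [uS Z0] := pos n lt_n; rewrite (hamiltonian_step lt_n tn).
  rewrite Hmx_E ?lt_eqF //; apply/posdef_intertwiner => //; by rewrite lt_eqF.
have [uS Z0] := wd n lt_n; split=> //.
have [t tl tn] := step_start lt_n.
by have := pos t tl; rewrite (hamiltonian_step lt_n tn) Hmx_E //
  posdef_intertwiner.
Qed.

End Hamiltonian.

(** * Canonical systems *)

Section Canonical.
Variables (R : realType) (d : nat) (C : d.+1.-tuple R[i]).
Local Notation mu := (@lebesgue_measure R).

Lemma posdefmx_semi n (A : 'M[R]_n) : posdefmx A -> possemidefmx A.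
Proof.
move=> [sA pos]; split=> // v; have [->|/pos/ltW //] := eqVneq v 0.
by rewrite /quad_form mulmx0 mxE.
Qed.

Lemma posdefmx_neq0 n (A : 'M[R]_n.+1) : posdefmx A -> A != 0.
Proof.
move=> [_ pos]; have v0 : (delta_mx 0 0 : 'cV[R]_n.+1) != 0.
  by apply/negP => /eqP/colP/(_ 0)/eqP; rewrite !mxE !eqxx oner_eq0.
by apply: contraTneq (pos _ v0) => ->;
  rewrite /quad_form mulmx0 mul0mx mxE ltxx.
Qed.

Lemma integrable_hamiltonian (K : set R) (i j : 'I_2) : measurable K ->
  mu.-integrable K (fun t => (hamiltonian C t i j)%:E).
Proof.
move=> mK.
rewrite (_ : (fun t => _) = fun t => (\sum_(1 <= n < d.+1)
   ((Hmx C n i j)%:E * (\1_[set` `[((freqr d)%:R * n.-1%:R / 2),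
     ((freqr d)%:R * n%:R / 2)[] t)%:E))%E); last first.
  apply/funext => t; rewrite /hamiltonian summxE -sumEFin big_mkcond.
  apply: eq_bigr => n _; rewrite indicE /= mem_setE in_itv /=.
  by case: ifP => _; rewrite ?mule1 ?mule0.
apply: integrable_sum => // n _; apply: integrableZl => //.
have := integrable_indic_itv ((freqr d)%:R * n.-1%:R / 2 : R)
  ((freqr d)%:R * n%:R / 2) true true.
by apply: integrableS.
Qed.

Lemma posdef_canonical l :
  (forall t : R, 0 <= t < l -> posdefmx (hamiltonian C t)) ->
  canonical_system l (hamiltonian C).
Proof.
move=> pos; split.
- by apply: aeW => t; rewrite in_itv /= => /pos/posdefmx_semi.
- move=> A mA sub A0 H0; have [E|/set0P[t At]] := eqVneq A set0.
    by rewrite E measure0 ltxx in A0.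
  have := sub t At; rewrite /= in_itv /= => /pos/posdefmx_neq0.
  by rewrite H0 ?eqxx.
- move=> K i j cK _; apply: integrable_hamiltonian.
  by apply: measurable_realfun.compact_measurable.
Qed.

End Canonical.

(** * The complex exponential *)

Section ComplexExponential.
Variable R : realType.
Local Notation Rec := complex.Re.
Local Notation Imc := complex.Im.
Implicit Types z w h k : R[i].

Lemma complex_eq z w : Rec z = Rec w -> Imc z = Imc w -> z = w.
Proof. by move=> er ei; apply/eqP; rewrite eq_complex er ei !eqxx. Qed.

Lemma ReM z w : Rec (z * w) = Rec z * Rec w - Imc z * Imc w.
Proof. by case: z w => [a b] [a' b']. Qed.

Lemma ImM z w : Imc (z * w) = Rec z * Imc w + Imc z * Rec w.
Proof. by case: z w => [a b] [a' b']. Qed.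

Lemma ReDc z w : Rec (z + w) = Rec z + Rec w.
Proof. by case: z w => [a b] [a' b']. Qed.

Lemma ImDc z w : Imc (z + w) = Imc z + Imc w.
Proof. by case: z w => [a b] [a' b']. Qed.

Lemma Re_conj z : Rec z^* = Rec z. Proof. by case: z. Qed.
Lemma Im_conj z : Imc z^* = - Imc z. Proof. by case: z. Qed.

Lemma Re_cexp z : Rec (cexp z) = expR (Rec z) * cos (Imc z).
Proof. by rewrite /cexp ReM /= mul0r subr0. Qed.

Lemma Im_cexp z : Imc (cexp z) = expR (Rec z) * sin (Imc z).
Proof. by rewrite /cexp ImM /= mul0r addr0. Qed.

Lemma cexpD z w : cexp (z + w) = cexp z * cexp w.
Proof.
apply: complex_eq.
  by rewrite [RHS]ReM !Re_cexp !Im_cexp ReDc ImDc expRD cosD; ring.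
by rewrite [RHS]ImM !Re_cexp !Im_cexp ReDc ImDc expRD sinD; ring.
Qed.

Lemma cexp0 : cexp (0 : R[i]) = 1.
Proof.
apply: complex_eq; rewrite ?Re_cexp ?Im_cexp /= expR0 mul1r.
  by rewrite cos0.
by rewrite sin0.
Qed.

Lemma cexpMn z n : cexp (n%:R * z) = cexp z ^+ n.
Proof.
elim: n => [|n IHn]; first by rewrite mul0r cexp0.
by rewrite -natr1 mulrDl mul1r cexpD IHn exprSr.
Qed.

Lemma cexp_neq0 z : cexp z != 0.
Proof.
apply/eqP => z0; have := cexpD z (- z); rewrite subrr cexp0 z0 mul0r.
by move/eqP; rewrite oner_eq0.
Qed.

Lemma cexpN z : cexp (- z) = (cexp z)^-1.
Proof.
apply: (mulfI (cexp_neq0 z)); rewrite -cexpD subrr cexp0 divff //.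
exact: cexp_neq0.
Qed.

Lemma conj_cexp z : (cexp z)^* = cexp z^*.
Proof.
apply: complex_eq; rewrite ?Re_conj ?Im_conj ?Re_cexp ?Im_cexp Re_conj Im_conj.
  by rewrite cosN.
by rewrite sinN mulrN.
Qed.

Lemma norm_cexp z : `|cexp z| = (expR (Rec z))%:C%C.
Proof.
rewrite normc_def Re_cexp Im_cexp !exprMn -mulrDr cos2Dsin2 mulr1.
by rewrite sqrtr_sqr ger0_norm // ltW // expR_gt0.
Qed.

(** Polar coordinates; [acos] gives the argument up to the sign of the imaginary
    part. *)
Lemma cexp_surj w : w != 0 -> exists z, cexp z = w.
Proof.
case: w => [a b] w0; pose r := Num.sqrt (a ^+ 2 + b ^+ 2).
have s0 : 0 < a ^+ 2 + b ^+ 2.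
  rewrite lt_def addr_ge0 ?sqr_ge0 // andbT paddr_eq0 ?sqr_ge0 // !sqrf_eq0.
  by apply: contra w0 => /andP[/eqP-> /eqP->].
have r0 : 0 < r by rewrite sqrtr_gt0.
have rE : r ^+ 2 = a ^+ 2 + b ^+ 2 by rewrite sqr_sqrtr // ltW.
have ar : -1 <= a / r <= 1.
  rewrite -ler_norml normrM normfV (gtr0_norm r0) ler_pdivrMr // mul1r.
  by rewrite -ler_sqr ?nnegrE ?normr_ge0 ?(ltW r0) // rE real_normK ?num_real
    // lerDl sqr_ge0.
have ca : cos (acos (a / r)) = a / r by rewrite acosK // in_itv.
have sa : sin (acos (a / r)) = `|b| / r.
  rewrite sin_acos //.
  have -> : 1 - (a / r) ^+ 2 = (b / r) ^+ 2.
    rewrite !exprMn !exprVn rE; field; exact: lt0r_neq0.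
  by rewrite sqrtr_sqr normrM normfV (gtr0_norm r0).
have [b0|b0] := leP 0 b.
  exists (Complex (ln r) (acos (a / r))).
  apply: complex_eq; rewrite ?Re_cexp ?Im_cexp /= lnK ?posrE // ?ca ?sa
    ?(ger0_norm b0);
  by rewrite mulrC divfK // gt_eqF.
exists (Complex (ln r) (- acos (a / r))).
apply: complex_eq; rewrite ?Re_cexp ?Im_cexp /= lnK ?posrE // ?cosN ?sinN ?ca
  ?sa ?(ltr0_norm b0).
  by rewrite mulrC divfK // gt_eqF.
by rewrite mulNr opprK mulrC divfK // gt_eqF.
Qed.

(** A form of differentiability at 0 without quotients, so that it can be
    applied to the real and to the imaginary part of a complex increment, either
    of which may vanish. *)
Lemma derive_remainder (F : R -> R) (a e : R) :
  is_derive (0 : R) 1 F a -> 0 < e ->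
  \forall x \near (0 : R), `|F x - F 0 - a * x| <= e * `|x|.
Proof.
move=> [dF aE] e0.
have : (fun h : R => h^-1 *: ((F \o shift 0) (h *: 1) - F 0)) @ 0^' --> a.
  by rewrite -aE; exact: dF.
move/cvgrPdist_le/(_ e e0) => H'.
have H : \forall x \near (0 : R), x != 0 ->
    `|a - x^-1 *: (F (x *: 1 + 0) - F 0)| <= e by exact: H'.
near=> x; have [->|x0] := eqVneq x 0.
  by rewrite !subrr mulr0 subr0 normr0 mulr0.
have le_e : `|a - x^-1 *: (F (x *: 1 + 0) - F 0)| <= e.
  by move: x0; near: x.
have -> : F x - F 0 - a * x =
    - (a - x^-1 *: (F (x *: 1 + 0) - F 0)) * x.
  have -> : x *: (1 : R) + 0 = x by rewrite addr0 [LHS]mulr1.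
  by rewrite -[_ *: _]/(_ * _); field.
by rewrite normrM normrN ler_wpM2r.
Unshelve. all: by end_near.
Qed.

Lemma sqrt_le_norm (a b : R) : Num.sqrt (a ^+ 2 + b ^+ 2) <= `|a| + `|b|.
Proof.
have -> : `|a| + `|b| = Num.sqrt ((`|a| + `|b|) ^+ 2).
  by rewrite sqrtr_sqr [RHS]ger0_norm // addr_ge0.
rewrite ler_wsqrtr // sqrrD !real_normK ?num_real // addrAC lerDl.
by rewrite mulrn_wge0 // mulr_ge0.
Qed.

(** Real differentiability of the exponential, the cosine and the sine at 0
    suffices: the real and imaginary parts of e^h - 1 - h are sums of their
    remainders and of products of two small quantities. *)
Lemma cexp_remainder (e : R) : 0 < e ->
  exists2 D : R, 0 < D &
    forall h, `|h| < D%:C%C -> `|cexp h - 1 - h| <= e%:C%C * `|h|.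
Proof.
(* The two parts contribute 3 c |h| and 4 c |h|, whence the 7. *)
move=> e0; pose c := Num.min (e / 7) 1.
have c0 : 0 < c by rewrite lt_min ltr01 divr_gt0.
have c1 : c <= 1 by rewrite ge_min lexx orbT.
have ce : 7 * c <= e by rewrite mulrC -ler_pdivlMr // ge_min lexx.
have dexp : is_derive (0 : R) 1 expR 1 by apply: is_derive_eq; rewrite expR0.
have dcos : is_derive (0 : R) 1 cos 0 by apply: is_derive_eq;
  rewrite sin0 oppr0.
have dsin : is_derive (0 : R) 1 sin 1 by apply: is_derive_eq; rewrite cos0.
have H : \forall x \near (0 : R), [/\ `|expR x - expR 0 - 1 * x| <= c * `|x|,
   `|cos x - cos 0 - 0 * x| <= c * `|x| & `|sin x - sin 0 - 1 * x| <= c * `|x|].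
  have E1 := derive_remainder dexp c0; have E2 := derive_remainder dcos c0.
  have E3 := derive_remainder dsin c0.
  by near=> x; split; near: x.
move: H => /nbhs_ballP[r /= r0 H].
exists (Num.min r c); first by rewrite lt_min r0 c0.
case=> x y; rewrite normc_def /= ltcR => xy.
set n := Num.sqrt _ in xy *.
have xn : `|x| <= n.
  by rewrite -sqrtr_sqr ler_wsqrtr // lerDl sqr_ge0.
have yn : `|y| <= n.
  by rewrite -sqrtr_sqr ler_wsqrtr // lerDr sqr_ge0.
move: xy; rewrite lt_min => /andP[nr nc].
have [|ex _ _] := H x.
  by rewrite /ball /= sub0r normrN (le_lt_trans xn).
have [|_ ey sy] := H y.
  by rewrite /ball /= sub0r normrN (le_lt_trans yn).
rewrite expR0 mul1r in ex; rewrite cos0 mul0r subr0 in ey.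
rewrite sin0 mul1r subr0 in sy.
have n0 : 0 <= n by apply: sqrtr_ge0.
have cn0 : 0 <= c * n by rewrite mulr_ge0 // ltW.
have {}ex : `|expR x - 1 - x| <= c * n.
  by apply: le_trans ex _; rewrite ler_pM2l.
have {}ey : `|cos y - 1| <= c * n by apply: le_trans ey _; rewrite ler_pM2l.
have {}sy : `|sin y - y| <= c * n by apply: le_trans sy _; rewrite ler_pM2l.
have sy2 : `|sin y| <= 2 * n.
  rewrite -[sin y](subrK y) (le_trans (ler_normD _ _)) //.
  rewrite mulr2n mulrDl mul1r lerD // (le_trans sy) // ler_piMl //.
have xc : `|x| <= c by rewrite (le_trans xn) // ltW.
have x1 : `|x| <= 1 by rewrite (le_trans xc).
have re : `|Rec (cexp (Complex x y) - 1 - Complex x y)| <= 3 * (c * n).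
  have -> : Rec (cexp (Complex x y) - 1 - Complex x y) =
      (expR x - 1 - x) * cos y + ((cos y - 1) + x * (cos y - 1)).
    by rewrite !ReDc Re_cexp /=; ring.
  apply: le_trans (ler_normD _ _) _;
    apply: (@le_trans _ _ (c * n + (c * n + c * n))).
    apply: lerD; last (apply: le_trans (ler_normD _ _) _; apply: lerD => //).
      by rewrite normrM (le_trans (ler_piMr _ (cos_max _))).
    by rewrite normrM (le_trans (ler_piMl _ x1)).
  by rewrite (_ : 3 * _ = c * n + (c * n + c * n)) //; ring.
have im : `|Imc (cexp (Complex x y) - 1 - Complex x y)| <= 4 * (c * n).
  have -> : Imc (cexp (Complex x y) - 1 - Complex x y) =
      (expR x - 1 - x) * sin y + ((sin y - y) + x * sin y).
    by rewrite !ImDc Im_cexp /=; ring.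
  apply: le_trans (ler_normD _ _) _.
  apply: (@le_trans _ _ (c * n + (c * n + c * (2 * n)))).
    apply: lerD; last (apply: le_trans (ler_normD _ _) _; apply: lerD => //).
      by rewrite normrM (le_trans (ler_piMr _ (sin_max _))).
    by rewrite normrM ler_pM.
  by rewrite (_ : 4 * _ = c * n + (c * n + c * (2 * n))) //; ring.
rewrite normc_def -rmorphM lecR.
apply: le_trans (sqrt_le_norm _ _) _.
apply: le_trans (lerD re im) _.
rewrite -mulrDl mulrA ler_wpM2r // -natrD; exact: ce.
Unshelve. all: by end_near.
Qed.

(** By the functional equation it is enough to differentiate at 0. *)
Lemma differentiable_cexp (z : R[i]^o) :
  differentiable (@cexp R : R[i]^o -> R[i]^o) z.
Proof.
apply/derivable1_diffP.
have E : (fun h : R[i]^o => (h : R[i])^-1 * (cexp h - 1) : R[i]^o) @ 0^'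
    --> (1 : R[i]^o).
  apply/cvgrPdist_le => e e0.
  have /complex_realP[er erE] : e \is Num.real by rewrite gtr0_real.
  have er0 : 0 < er by rewrite -ltcR -erE.
  have [D D0 HD] := cexp_remainder er0.
  have D0' : 0 < D%:C%C :> R[i] by rewrite ltcR.
  near=> h.
  have h0 : h != 0 by near: h; exact: nbhs_dnbhs_neq.
  have hD : `|h| < D%:C%C by near: h; apply: dnbhs0_lt.
  have -> : 1 - h^-1 * (cexp h - 1) = - (h^-1 * (cexp h - 1 - h)).
    by field.
  rewrite normrN normrM normfV ler_pdivrMl ?normr_gt0 // mulrC erE.
  exact: HD.
rewrite /derivable.
have -> : (fun h : R[i] => h^-1 *:
      (((@cexp R : R[i]^o -> R[i]^o) \o shift z) (h *: (1 : R[i]^o))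
       - (cexp z : R[i]^o))) =
   (fun h => cexp z * (h^-1 * (cexp h - 1))).
  apply/funext => h /=.
  rewrite -[_ *: (cexp _ - _)]/(_ * _) -[h *: 1]/(h * 1) mulr1 cexpD.
  ring.
have H : (fun h : R[i]^o => (cexp z * (h^-1 * (cexp h - 1)) : R[i]^o)) @ 0^' -->
    (cexp z * 1 : R[i]^o) by apply: cvgM E; exact: cvg_cst.
exact: (cvgP _ H).
Unshelve. all: by end_near.
Qed.

End ComplexExponential.

(** * Hermite-Biehler exponential polynomials *)

Section HermiteBiehler.
Variables (R : realType) (d : nat) (C : d.+1.-tuple R[i]).
Hypothesis C_ends : C`_0 * C`_d != 0.
Hypothesis d_ge1 : (1 <= d)%N.
Local Notation f := (fpoly C).
Local Notation Rec := complex.Re.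
Local Notation Imc := complex.Im.

(** The variable w in E(z) = e^(iLz) f(w). *)
Definition node (z : R[i]) : R[i] := cexp (- 'i * (freqr d)%:R * z).
Definition carrier (z : R[i]) : R[i] := cexp ('i * (freqL d)%:R * z).

Lemma freq_relation : (2 * freqL d = freqr d * d)%N.
Proof.
rewrite /freqL /freqr; case: ifP => // dO.
by rewrite mul1n -[RHS](odd_double_half d) dO add0n mul2n.
Qed.

Lemma exp_poly_node (z : R[i]) : exp_poly C z = carrier z * f.[node z].
Proof.
rewrite (horner_coef_wide (n := d.+1)) ?size_fpoly // mulr_sumr.
apply: eq_bigr => j _; rewrite coef_fpoly [RHS]mulrCA; congr (C`_j * _).
rewrite /carrier /node -cexpMn -cexpD; congr cexp.
by rewrite rmorphB /= -!pmulrn natrM; ring.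
Qed.

(** This is 2 L = r d. *)
Lemma node_carrier (z : R[i]) : carrier z ^+ 2 * node z ^+ d = 1.
Proof.
rewrite /carrier /node -!cexpMn -cexpD -[RHS](cexp0 R); congr cexp.
have e : 2 * (freqL d)%:R = (freqr d)%:R * d%:R :> R[i].
  by rewrite -!natrM freq_relation.
transitivity ('i * z * (2 * (freqL d)%:R - (freqr d)%:R * d%:R) : R[i]);
  first by ring.
by rewrite e subrr mulr0.
Qed.

Lemma conj_node (z : R[i]) : node z^* = ((node z)^-1)^*.
Proof.
rewrite /node -cexpN conj_cexp; congr cexp.
by rewrite !mulNr opprK !rmorphM /= conjCi rmorph_nat !mulNr.
Qed.

Lemma conj_carrier (z : R[i]) : (carrier z^*)^* = carrier z * node z ^+ d.
Proof.
apply: (mulfI (cexp_neq0 _ : carrier z != 0));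
  rewrite mulrA -expr2 node_carrier.
rewrite /carrier conj_cexp !rmorphM /= conjCi rmorph_nat conjCK -cexpD.
by rewrite !mulNr subrr cexp0.
Qed.

Lemma sharp_node (z : R[i]) : sharp (exp_poly C) z =
  carrier z * (node z ^+ d * (f.[((node z)^-1)^*])^*).
Proof.
by rewrite /sharp exp_poly_node rmorphM /= conj_carrier conj_node mulrA.
Qed.

Lemma Re_node (z : R[i]) : Rec (- 'i * (freqr d)%:R * z) = (freqr d)%:R * Imc z.
Proof.
have rE : (freqr d)%:R = real_complex R (freqr d)%:R by rewrite rmorph_nat.
rewrite -complexiE rE.
by case: z => x y; rewrite !ReM !ImM /=; ring.
Qed.

Lemma norm_node (z : R[i]) : `|node z| = (expR ((freqr d)%:R * Imc z))%:C%C.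
Proof. by rewrite norm_cexp Re_node. Qed.

Lemma entire_exp_poly : entire (exp_poly C).
Proof.
move=> z; apply/derivable1_diffP.
pose term (j : 'I_d.+1) : R[i]^o -> R[i]^o := fun z =>
  C`_j * cexp ('i * ((freqL d)%:Z - (freqr d * j)%N%:Z)%:~R * z).
have -> : (exp_poly C : R[i]^o -> R[i]^o) = \sum_(j < d.+1) term j.
  by apply/funext => w; rewrite fct_sumE.
apply: differentiable_sum => j.
set k := 'i * ((freqL d)%:Z - (freqr d * j)%N%:Z)%:~R : R[i].
have dk : differentiable (fun u : R[i]^o => (k : R[i]) *: u) (z : R[i]^o).
  by apply: differentiableZ.
have := differentiable_comp dk (differentiable_cexp (k *: z)).
by move/(differentiableZ (C`_j)).
Qed.

(** The difference of the squares is (|w|^2 - 1) (1 - |a|^2). *)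
Lemma blaschke_lt (a w : R[i]) : `|a| < 1 -> 1 < `|w| ->
  `|1 - a^* * w| < `|w - a|.
Proof.
move=> a1 w1; rewrite -ltr_sqr ?nnegrE // -subr_gt0.
have -> : `|w - a| ^+ 2 - `|1 - a^* * w| ^+ 2 =
    (`|w| ^+ 2 - 1) * (1 - `|a| ^+ 2).
  by rewrite !normCK !rmorphB !rmorphM /= conjCK rmorph1; ring.
by rewrite mulr_gt0 // subr_gt0 ?exprn_egt1 ?exprn_ilt1.
Qed.

Lemma norm_sharp_split s w : w != 0 -> size s = d -> f = C`_d *: monic_of s ->
  `|w ^+ d * (f.[(w^-1)^*])^*| = `|C`_d| * \prod_(a <- s) `|1 - a^* * w|.
Proof.
move=> w0 sz ->; rewrite hornerZ normrM norm_conjC normrM mulrCA; congr (_ * _).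
rewrite /monic_of horner_prod !normr_prod -sz.
have -> : `|w ^+ size s| = \prod_(a <- s) `|w|.
  by rewrite big_const_seq count_predT iter_mulr_1 normrX.
rewrite -big_split /=; apply: eq_bigr => a _.
rewrite hornerXsubC -[`|_ - a|]norm_conjC -normrM rmorphB /= conjCK mulrBr.
by rewrite mulfV // mulrC.
Qed.

(** A root w with |w| >= 1 equals e^(-irz) for some z with Im z >= 0, by
    surjectivity of the exponential, and z is then a zero of E. *)
Lemma HB_roots : HB_class (exp_poly C) <-> forall w, root f w -> `|w| < 1.
Proof.
have r0 : (freqr d)%:R != 0 :> R[i] by rewrite pnatr_eq0 /freqr; case: odd.
have rR : 0 < (freqr d)%:R :> R by rewrite ltr0n /freqr; case: odd.
split=> [[_ nz lt] w rw|roots].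
  rewrite real_ltNge ?realE ?normr_ge0 ?ler01 //; apply/negP => w1.
  have w0 : w != 0 by rewrite -normr_gt0 (lt_le_trans ltr01).
  have [u uw] := cexp_surj w0.
  (* Solve - i r z = u. *)
  pose z := 'i * u / (freqr d)%:R.
  have zw : node z = w.
    rewrite -uw /node; congr cexp; rewrite /z.
    have ii : 'i * 'i = -1 :> R[i] by rewrite -expr2 sqrCi.
    transitivity (- ('i * 'i) * u * ((freqr d)%:R / (freqr d)%:R));
      first by ring.
    by rewrite ii opprK mul1r divff // mulr1.
  have E0 : exp_poly C z = 0 by rewrite exp_poly_node zw (rootP rw) mulr0.
  have : 0 <= Imc z.
    rewrite leNgt; apply/negP => z0.
    move: w1; rewrite -zw norm_node -[1]/(1%:C%C) lecR; apply/negP.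
    by rewrite -ltNge -[X in _ < X]expR0 ltr_expR pmulr_rlt0.
  rewrite le_eqVlt => /orP[/eqP z0|z0].
    have zE : z = (Rec z)%:C%C by apply: complex_eq; rewrite /= -?z0.
    by have := nz (Rec z); rewrite -zE E0 eqxx.
  by have := lt z z0; rewrite E0 normr0 normr_lt0.
split; first exact: entire_exp_poly.
  move=> x; rewrite exp_poly_node mulf_neq0 ?cexp_neq0 //.
  apply/negP => /eqP/rootP/roots; rewrite norm_node /= mulr0 expR0.
  by rewrite -[ltRHS]/(1%:C%C) ltxx.
move=> z z0; rewrite sharp_node exp_poly_node [ltLHS]normrM [ltRHS]normrM.
have [s [sz fE _]] := fpoly_split C_ends.
have w1 : 1 < `|node z|.
  by rewrite norm_node -[1]/(1%:C%C) ltcR expR_gt1 mulr_gt0.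
rewrite ltr_pM2l ?normr_gt0 ?cexp_neq0 // (norm_sharp_split _ sz fE)
  ?cexp_neq0 //.
rewrite fE hornerZ normrM ltr_pM2l ?normr_gt0 ?(fpolyd_neq0 C_ends) //.
rewrite /monic_of horner_prod normr_prod big_seq [ltRHS]big_seq.
apply: ltr_prod.
  by move: sz; case: s fE => [|a s] // _ sz; [move: d_ge1;
    rewrite -sz|rewrite /= mem_head].
move=> a a_s; rewrite normr_ge0 hornerXsubC blaschke_lt //.
by apply: roots; rewrite (root_fpoly C_ends _ fE).
Qed.

End HermiteBiehler.

Theorem corollary1p2 (R : realType) (d : nat) (C : d.+1.-tuple R[i])
    (d_ge1 : (1 <= d)%N) (C_ends : C`_0 * C`_d != 0) :
  let l : R := (freqL d)%:R in
  let cond4 := hamiltonian_well_defined C /\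
      (forall t : R, 0 <= t < l -> posdefmx (hamiltonian C t)) in
  [<-> HB_class (exp_poly C);
       forall w : R[i], root (fpoly C) w -> `|w| < 1;
       forall n : nat, (1 <= n <= d)%N -> 0 < Ddet C n;
       cond4]
  /\ (cond4 -> canonical_system l (hamiltonian C)).
Proof.
move=> l cond4; split; last by move=> [_ pos]; apply: posdef_canonical.
tfae.
- exact: (HB_roots C_ends d_ge1).1.
- exact: (Ddet_roots C_ends).2.
- exact: (Ddet_hamiltonian C_ends).1.
- move=> c4; apply/(HB_roots C_ends d_ge1)/(Ddet_roots C_ends).
  exact/(Ddet_hamiltonian C_ends).
Qed.
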